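(* Let $P\in\mathbb R^{n\times n}$ be symmetric positive definite, let $f$ and $g_1,\dots,g_k$ be smooth vector fields on $\mathbb R^n$, $G=(g_1,\dots,g_k)$, and $x_0\in\mathbb R^n$. Consider the infinite-horizon functional $J_0^\infty(u)=\int_0^{+\infty}x_u(t)'Px_u(t)\,dt$ along trajectories $x_u$ of $\dot x=f(x)+G(x)u$, $x(0)=x_0$. If the system is locally stabilizable of order $\alpha>\frac1p$ with $p\in[1,2[$, then $J_0^\infty$ does not have an $L_{1,loc}-(L_p\cap L_\infty)$ Lavrentiev gap, i.e. $$\inf_{u\in L_p^k[0,+\infty[\,\cap\, L_\infty^k[0,+\infty[}J_0^\infty(u)=\inf_{u\in L_{1,loc}^k}J_0^\infty(u).$$ For $p\in[2,+\infty]$ the same equality holds provided the system is locally stabilizable of order $\alpha>\frac12$.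
   Context: The functional $J_0^\infty(u)$ is set equal to $+\infty$ for any control $u$ for which the control system has no solution on $[0,+\infty[$. $L_{1,loc}^k$ denotes the locally integrable functions $[0,+\infty[\to\mathbb R^k$. The control-affine system $\dot x=f(x)+G(x)u$ is said to be locally stabilizable of order $\alpha$ if there exist a Lipschitzian feedback $\bar u(x)$ and a constant $C<+\infty$ such that $\bar u(0)=0$ and $|x(t;x_0)|\le C|x_0|(t+1)^{-\alpha}$ (for $t\ge0$) holds for every $x_0$ in some neighborhood of the origin, where $x(\cdot;x_0)$ is the trajectory of $\dot x=f(x)+G(x)\bar u(x)$, $x(0)=x_0$. *)

(* Defs.v *)
From HB Require Import structures.
From mathcomp Require Import all_boot all_order all_algebra.
From mathcomp Require Import all_classical all_reals all_analysis.

Set Implicit Arguments.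
Unset Strict Implicit.
Unset Printing Implicit Defensive.

Import Order.TTheory GRing.Theory Num.Theory.
Import numFieldNormedType.Exports.

Local Open Scope classical_set_scope.
Local Open Scope ring_scope.

(* The library norm on 'cV[R]_n is the sup norm. *)

Definition enorm (R : realType) (n : nat) (x : 'cV[R]_n) : R :=
  Num.sqrt (\sum_i x i 0 ^+ 2).

Definition quadform (R : realType) (n : nat) (P : 'M[R]_n) (x : 'cV[R]_n) : R :=
  (x^T *m P *m x) 0 0.

Definition sym_posdef (R : realType) (n : nat) (P : 'M[R]_n) : Prop :=
  P^T = P /\ forall x : 'cV[R]_n, x != 0 -> 0 < quadform P x.

Fixpoint class_C (R : realType) (U V : normedModType R) (m : nat) (F : U -> V)
    {struct m} : Prop :=
  match m with
  | 0%N => continuous F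
  | m'.+1 => (forall x, differentiable F x) /\
             (forall v : U, class_C m' (fun x => 'D_v F x))
  end.

Definition smooth (R : realType) (U V : normedModType R) (F : U -> V) : Prop :=
  forall m, class_C m F.

Definition fields_mx (R : realType) (n k : nat) (g : 'I_k -> 'cV[R]_n -> 'cV[R]_n)
    (x : 'cV[R]_n) : 'M[R]_(n, k) :=
  \matrix_(i, j) g j x i 0.

(* Functions of time are total on R, but only their values on [0, +oo[ are
   used. *)

(* Caratheodory solution on [0, +oo[ of x' = f x + G x u(t), x(0) = x0. *)
Definition trajectory (R : realType) (n k : nat) (f : 'cV[R]_n -> 'cV[R]_n)
    (G : 'cV[R]_n -> 'M[R]_(n, k)) (x0 : 'cV[R]_n) (u : R -> 'cV[R]_k)
    (x : R -> 'cV[R]_n) : Prop :=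
  {within `[0, +oo[, continuous x} /\
  forall (t : R) (i : 'I_n), 0 <= t ->
    let v := fun s : R => (f (x s) + G (x s) *m u s) i 0 in
    lebesgue_measure.-integrable `[0, t] (EFin \o v) /\
    x t i 0 = x0 i 0 + \int[lebesgue_measure]_(s in `[0, t]) v s.

(* When u is locally integrable and f, G are smooth, the trajectory chosen by
   [cid] is unique on [0, +oo[. *)
Definition J0infty (R : realType) (n k : nat) (P : 'M[R]_n)
    (f : 'cV[R]_n -> 'cV[R]_n) (G : 'cV[R]_n -> 'M[R]_(n, k)) (x0 : 'cV[R]_n)
    (u : R -> 'cV[R]_k) : \bar R :=
  match pselect (exists x, trajectory f G x0 u x) with
  | left ex =>
      (\int[lebesgue_measure]_(t in `[0%R, +oo[) (quadform P (sval (cid ex) t))%:E)%E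
  | right _ => +oo%E
  end.

Definition L1loc (R : realType) (k : nat) : set (R -> 'cV[R]_k) :=
  [set u | forall (i : 'I_k) (T : R), 0 <= T ->
     lebesgue_measure.-integrable `[0, T] (EFin \o (fun t => u t i 0))].
Arguments L1loc : clear implicits.

(* L_p^k[0, +oo[: each component, extended by 0 to negative times, is in
   L_p(R). *)
Definition Lp (R : realType) (k : nat) (p : \bar R) : set (R -> 'cV[R]_k) :=
  [set u | forall i : 'I_k,
     ((fun t => u t i 0) \_ `[0, +oo[) \in Lfun lebesgue_measure p].
Arguments Lp {R} k p.

(* The Lipschitz property does not depend on the choice of norms. The open-loop
   control [ubar \o x] makes [x] a trajectory of x' = f x + G x ubar(x). *)
Definition locally_stabilizable (R : realType) (n k : nat)
    (f : 'cV[R]_n -> 'cV[R]_n) (G : 'cV[R]_n -> 'M[R]_(n, k)) (alpha : R) : Prop :=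
  exists (ubar : 'cV[R]_n -> 'cV[R]_k) (C : R),
    [/\ lipschitz ubar, ubar 0 = 0 &
        \forall x0 \near (0 : 'cV[R]_n),
          exists x : R -> 'cV[R]_n, trajectory f G x0 (ubar \o x) x /\
            forall t, 0 <= t -> enorm (x t) <= C * enorm x0 * (t + 1) `^ (- alpha)].

(* Main.v *)
(* Let u be a locally integrable control of finite cost with trajectory x.  Since
   the cost density is bounded below by c |x|^2, there are times T at which |x(T)|
   is arbitrarily small.  On [0, T] replace u by its componentwise truncation v at
   a high level: v is bounded and L1-close to u, so by Gronwall's inequality with
   the integrable kernel L (1 + |u|) its trajectory y stays uniformly close to x.
   After T switch to the stabilizing feedback.  The state then decays like
   |y(T)| (t - T + 1)^(-alpha), so the tail costs O(|y(T)|^2 / (2 alpha - 1)), and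
   the Lipschitz feedback control decays at the same rate, hence lies in L_p as
   soon as p alpha > 1. *)

Require Import Defs.
From mathcomp Require Import all_boot all_order all_algebra.
From mathcomp Require Import all_classical all_reals all_analysis.
From mathcomp Require Import measurable_realfun.
From mathcomp Require Import ring lra.
Import Order.TTheory GRing.Theory Num.Theory.
Import numFieldNormedType.Exports.
Set Implicit Arguments.
Unset Strict Implicit.
Unset Printing Implicit Defensive.
Local Open Scope classical_set_scope.
Local Open Scope ring_scope.

Local Notation mu := lebesgue_measure.

(** * Truncation and weighted integral kernels *)

(** The fields are only locally Lipschitz, so nothing guarantees beforehand that the truncated
    control has a trajectory up to [T]: existence and closeness must come out together. Both rest on
    one estimate: with the weight e^(a t), a large, integration against an integrable kernel halves
    weighted sup norms. Gronwall's bound and Picard iteration then become geometric series.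
    Gronwall's constant must be known before the truncation level is picked, so it is taken from the
    kernel of u, and the truncation error is charged as a perturbation. The order of choices avoids
    circularity: the smallness of |x(T)| depends on the tail only and is fixed first; it yields T;
    the accuracy on [0, T] depends on T and on the size of x there, and comes last. Two exponents
    interact: alpha > 1/2 pays for the cost, p alpha > 1 for the control. If p < 2 the second
    implies the first; if p >= 2 the first implies the second. The cost is defined through a chosen
    trajectory, so evaluating it on a constructed one calls for uniqueness. *)

Definition clip {R : realType} (M r : R) : R := Num.max (- M) (Num.min M r).

Section Clip.
Context {R : realType}.
Implicit Types M r s : R.

Lemma normr_clip M r : 0 <= M -> `|clip M r| <= M.
Proof.
by move=> M0; rewrite /clip ler_norml le_max lexx/= ge_max ge_min lexx andbT; lra.
Qed.

Lemma clip_id M r : `|r| <= M -> clip M r = r.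
Proof.
by rewrite ler_norml => /andP[a b]; rewrite /clip min_r// max_r.
Qed.

Lemma clip_cases M r : 0 <= M ->
  [\/ r <= - M /\ clip M r = - M, [/\ - M <= r, r <= M & clip M r = r] |
      M <= r /\ clip M r = M].
Proof.
move=> M0; rewrite /clip; have [rM|/ltW Mr] := leP r M.
  have [Mr|/ltW rM'] := leP (- M) r; first by constructor 2.
  by constructor 1.
by constructor 3; rewrite max_r//; lra.
Qed.

Lemma clip_lipschitz M r s : 0 <= M -> `|clip M r - clip M s| <= `|r - s|.
Proof.
move=> M0; have := ler_norm (r - s); have := ler_norm (s - r).
rewrite distrC ler_norml => ? ?; apply/andP.
by case: (clip_cases r M0) => [[? ->]|[? ? ->]|[? ->]];
  case: (clip_cases s M0) => [[? ->]|[? ? ->]|[? ->]]; split; lra.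
Qed.

Lemma normr_subr_clip M r : 0 <= M -> `|r - clip M r| <= `|r|.
Proof.
move=> M0; case: (clip_cases r M0) => [[? ->]|[? ? ->]|[? ->]];
  by case: (ler0P r) => ?; case: ler0P => ?; lra.
Qed.

Lemma normr_clip_le M r : 0 <= M -> `|clip M r| <= `|r|.
Proof.
by move=> M0; have := clip_lipschitz r 0 M0; rewrite (@clip_id M 0) ?normr0// !subr0.
Qed.

Lemma continuous_clip M : continuous (clip M).
Proof.
move=> x; apply: (@continuous_max _ _ (cst (- M)) (fun r => Num.min M r)).
  exact: cst_continuous.
by apply: (@continuous_min _ _ (cst M) id); [exact: cst_continuous|exact: cvg_id].
Qed.

Lemma measurable_clip M : measurable_fun setT (clip M).
Proof. by apply: continuous_measurable_fun; exact: continuous_clip. Qed.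

End Clip.

Section Kernel.
Context {R : realType}.
Implicit Types (D : set R) (h w l : R -> R).

Lemma integrable_measurable_fun D h :
  mu.-integrable D (EFin \o h) -> measurable_fun D h.
Proof. by move=> /measurable_int/measurable_EFinP. Qed.

Lemma le_norm_Rintegral_dom D h w : measurable D ->
  mu.-integrable D (EFin \o h) -> mu.-integrable D (EFin \o w) ->
  (forall s, D s -> `|h s| <= w s) ->
  `|\int[mu]_(s in D) h s| <= \int[mu]_(s in D) w s.
Proof.
move=> mD ih iw hw; apply: (le_trans (le_normr_Rintegral _ ih)) => //.
by apply: le_Rintegral => //; exact: integrable_norm.
Qed.

Lemma integrable_sub_clip D h M : 0 <= M -> measurable D ->
  mu.-integrable D (EFin \o h) ->
  mu.-integrable D (EFin \o (fun s => `|h s - clip M (h s)|)).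
Proof.
move=> M0 mD ih; apply: le_integrable (ih) => //.
  have mh : measurable_fun D h by exact: integrable_measurable_fun.
  apply/measurable_EFinP; apply: measurableT_comp => //.
  apply: measurable_funB => //; apply: measurableT_comp => //.
  exact: measurable_clip.
by move=> s Ds /=; rewrite lee_fin normr_id normr_subr_clip.
Qed.

Lemma clip_L1_approx D h (e : R) : 0 < e -> measurable D ->
  mu.-integrable D (EFin \o h) ->
  exists2 M : R, 0 < M & \int[mu]_(s in D) `|h s - clip M (h s)| <= e.
Proof.
move=> e0 mD ih.
have mh : measurable_fun D h by exact: integrable_measurable_fun.
(* Level [n.+1] keeps the truncation level positive. At each point the remainder vanishes once the
   level exceeds [|h s|], and it is dominated by [|h|]. *)
pose f_ (n : nat) := EFin \o (fun s => `|h s - clip n.+1%:R (h s)|).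
have cv : {ae mu, forall x, D x -> f_ ^~ x @ \oo --> (EFin \o cst 0) x}.
  apply: aeW => s Ds; apply: cvg_near_cst.
  near=> n; rewrite /f_ /=; rewrite clip_id ?subrr ?normr0//.
  near: n; exists (Num.truncn `|h s|).+1 => // n /= ns.
  apply: le_trans (ltW (truncnS_gt _)) _; rewrite ler_nat.
  exact: leq_trans ns _.
have [| | |_ _] := @dominated_convergence _ _ _ mu _ mD f_ (EFin \o cst 0)
  (EFin \o (fun s => `|h s|)) _ _ cv (integrable_norm ih).
- by move=> n; apply: measurable_int (integrable_sub_clip _ mD ih).
- exact/measurable_EFinP.
- apply: aeW => s n Ds /=; rewrite lee_fin normr_id.
  exact: normr_subr_clip.
rewrite integral0_eq => [|//].
move=> /fine_cvgP[_ /cvgrPdist_le /(_ e e0)] [N _ /(_ N (leqnn N))] /=.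
rewrite sub0r normrN => le_e; exists N.+1%:R => //.
exact: le_trans (ler_norm _) le_e.
Unshelve. all: by end_near. Qed.

Lemma Rintegral_expR (a t : R) : 0 < a -> 0 <= t ->
  \int[mu]_(s in `[0, t]) expR (a * s) = a^-1 * (expR (a * t) - 1).
Proof.
move=> a0; rewrite le_eqVlt => /predU1P[<-|t0].
  by rewrite set_itv1 Rintegral_set1 mulr0 expR0 subrr mulr0.
have D (s : R) : is_derive s 1 (fun x => a^-1 * expR (a * x)) (expR (a * s)).
  apply: is_derive_eq; rewrite /GRing.scale/= mulr1.
  by rewrite mulrCA mulVf ?mulr1 ?gt_eqF.
have C : continuous (fun s : R => expR (a * s)).
  move=> s; apply: (@continuous_comp _ _ _ ( *%R a) expR).
    exact: mulrl_continuous.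
  exact: continuous_expR.
have CF : continuous (fun s : R => a^-1 * expR (a * s)).
  move=> s; apply: (@continuous_comp _ _ _ (fun s => expR (a * s)) ( *%R a^-1)).
    exact: C.
  exact: mulrl_continuous.
rewrite /Rintegral (continuous_FTC2 (F := fun x => a^-1 * expR (a * x)) t0) => [|||].
- by rewrite /= mulr0 expR0 mulrBr.
- exact: continuous_subspaceT.
- split => [x _||].
  + by have /@ex_derive := D x.
  + exact/cvg_at_right_filter/CF.
  + exact/cvg_at_left_filter/CF.
- by move=> x _; rewrite derive1E; have /@derive_val := D x.
Qed.

Lemma integrable_expR (c a t : R) :
  mu.-integrable `[0, t] (EFin \o (fun s => c * expR (a * s))).
Proof.
apply: continuous_compact_integrable; first exact: segment_compact.
apply: continuous_subspaceT => s.
apply: (@continuous_comp _ _ _ (fun s => expR (a * s)) ( *%R c)).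
  apply: (@continuous_comp _ _ _ ( *%R a) expR).
    exact: mulrl_continuous.
  exact: continuous_expR.
exact: mulrl_continuous.
Qed.

(* Splitting l into its truncation at M plus an L1-small remainder gives
   int_0^t |l s| e^(a s) ds <= e^(a t) / 2 as soon as a >= 4 M. *)
Lemma weighted_kernel l (T : R) : mu.-integrable `[0, T] (EFin \o l) ->
  exists2 a : R, 0 < a & forall (h : R -> R) (t W : R), 0 <= t <= T -> 0 <= W ->
    mu.-integrable `[0, t] (EFin \o h) ->
    (forall s, 0 <= s <= t -> `|h s| <= `|l s| * (W * expR (a * s))) ->
    `|\int[mu]_(s in `[0, t]) h s| <= W / 2 * expR (a * t).
Proof.
move=> il; have mT : measurable `[0, T]%classic by exact: measurable_itv.
(* Each half contributes at most (W / 4) e^(a t): the truncated part because W M / a = W / 4, the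
   remainder because its L1 norm is at most 1/4 and its weight is bounded by the value at the right
   end [t]. *)
have [//|M M0 lM] := @clip_L1_approx _ _ (4^-1) _ mT il.
exists (4 * M); first lra.
move=> h t W /andP[t0 tT] W0 ih hl.
set a := 4 * M; pose r s := `|l s - clip M (l s)|.
have irT : mu.-integrable `[0, T] (EFin \o r).
  by apply: integrable_sub_clip => //; exact: ltW.
have st : `[0, t] `<=` `[0, T] by apply: subset_itvl; rewrite bnd_simp.
have ir : mu.-integrable `[0, t] (EFin \o r) by exact: integrableS irT.
have irW : mu.-integrable `[0, t] (EFin \o (fun s => W * expR (a * t) * r s)).
  by rewrite (_ : _ \o _ = (fun s => (W * expR (a * t))%:E * (EFin \o r) s)%E)//;
    exact: integrableZl.
have ie := integrable_expR (W * M) a t.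
apply: le_trans (@le_norm_Rintegral_dom _ _
  (fun s => W * M * expR (a * s) + W * expR (a * t) * r s) _ ih _ _) _ => //.
- rewrite (_ : EFin \o _ = (EFin \o (fun s => W * M * expR (a * s))%R) \+
     (EFin \o (fun s => W * expR (a * t) * r s)%R))%E//.
  exact: integrableD.
- move=> s; rewrite /= in_itv/= => /andP[s0 s_t].
  apply: le_trans (hl s _) _; first by rewrite s0.
  have lr : `|l s| <= M + r s.
    rewrite -[l s](subrK (clip M (l s))) addrC.
    by apply: le_trans (ler_normD _ _) _; rewrite lerD2r normr_clip// ltW.
  apply: le_trans (ler_wpM2r _ lr) _; first by rewrite mulr_ge0 ?expR_ge0.
  rewrite mulrDl mulrCA mulrA lerD// mulrC.
  rewrite ler_wpM2r ?normr_ge0// ler_wpM2l// ler_expR ler_wpM2l//.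
  by rewrite /a; lra.
rewrite RintegralD//.
have -> : \int[mu]_(x in `[0, t]) (W * M * expR (a * x)) =
    W * M * (a^-1 * (expR (a * t) - 1)).
  rewrite RintegralZl//; last first.
    by have := integrable_expR 1 a t; congr integrable; apply/funext => s /=; rewrite mul1r.
  by rewrite Rintegral_expR// /a; lra.
rewrite RintegralZl//.
have rt : \int[mu]_(x in `[0, t]) r x <= 4^-1.
  apply: le_trans lM; rewrite fine_le ?integrable_fin_num//.
  apply: ge0_subset_integral => //.
    exact: (measurable_int mu irT).
  by move=> s _; rewrite lee_fin normr_ge0.
have -> : W * M * (a^-1 * (expR (a * t) - 1)) = W / 4 * (expR (a * t) - 1).
  by rewrite /a; field; rewrite gt_eqF.
have E0 := expR_ge0 (a * t).
have : W * expR (a * t) * \int[mu]_(x in `[0, t]) r x <= W * expR (a * t) * 4^-1.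
  by rewrite ler_wpM2l// mulr_ge0.
by lra.
Qed.

End Kernel.

(** * Column vectors and quadratic forms *)

Section VectorNorm.
Context {R : realType}.

Lemma coord_le_norm m n (x : 'M[R]_(m, n)) i j : `|x i j| <= `|x|.
Proof.
by rewrite {2}/Num.norm /= mx_normrE; apply: (le_bigmax _ (fun ij => `|x ij.1 ij.2|) (i, j)).
Qed.

Lemma norm_le_coord m n (x : 'M[R]_(m, n)) (c : R) : 0 <= c ->
  (forall i j, `|x i j| <= c) -> `|x| <= c.
Proof.
by move=> c0 xc; rewrite /Num.norm /= mx_normrE; apply/bigmax_leP; split => // -[].
Qed.

Lemma norm_cV_le n (x : 'cV[R]_n) (c : R) : 0 <= c ->
  (forall i, `|x i 0| <= c) -> `|x| <= c.
Proof. by move=> c0 xc; apply: norm_le_coord => // i j; rewrite ord1. Qed.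

Lemma cV_subE n (x y : 'cV[R]_n) i : (x - y) i 0 = x i 0 - y i 0.
Proof. by rewrite !mxE. Qed.

Lemma cvg_cV (T : Type) (F : set_system T) (FF : Filter F) n
    (y : T -> 'cV[R]_n) (l : 'cV[R]_n) :
  (forall i, y t i 0 @[t --> F] --> l i 0) -> y t @[t --> F] --> l.
Proof.
move=> yl; apply/cvgrPdist_le => e e0.
have : \forall t \near F, forall i, `|l i 0 - y t i 0| <= e.
  apply: filter_forall => i.
  by move/cvgrPdist_le : (yl i) => /(_ _ e0).
apply: filterS => t le_e; apply: norm_cV_le => [|i]; first exact: ltW.
by rewrite !mxE.
Qed.

Lemma within_continuous_cV (A : set R) n (y : R -> 'cV[R]_n) :
  (forall i, {within A, continuous (fun t => y t i 0)}) -> {within A, continuous y}.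
Proof. by move=> cy t; apply: cvg_cV => i; exact: cy. Qed.

Lemma within_continuous_coord (A : set R) n (y : R -> 'cV[R]_n) i :
  {within A, continuous y} -> {within A, continuous (fun t => y t i 0)}.
Proof.
move=> cy t; have := cy t.
by move=> /(@cvg_comp _ _ _ _ (fun M : 'cV[R]_n => M i 0)); apply; exact: coord_continuous.
Qed.

Lemma within_continuous_comp_cV (A : set R) n (V : normedModType R)
    (y : R -> 'cV[R]_n) (F : 'cV[R]_n -> V) :
  continuous F -> {within A, continuous y} -> {within A, continuous (F \o y)}.
Proof. by move=> cF; apply: within_continuous_comp => z _; exact: cF. Qed.

(** Transposition is continuous and carries the Heine-Borel property of row vectors over to
    columns. *)
Lemma compact_cV_bounded_closed n (A : set 'cV[R]_n) :
  (exists r : R, forall x, A x -> `|x| <= r) -> closed A -> compact A.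
Proof.
move=> [r Ar] cA.
have ct : continuous (fun M : 'rV[R]_n => M^T).
  move=> M; apply: (@cvg_cV _ _ (nbhs_filter M)) => i.
  rewrite (_ : (fun _ => _) = fun N : 'rV[R]_n => N 0 i); last first.
    by apply/funext => N; rewrite mxE.
  by rewrite mxE; exact: coord_continuous.
have -> : A = trmx @` (trmx @^-1` A : set 'rV[R]_n).
  apply/seteqP; split => [x Ax|_ [y Ay <-]//].
  by exists x^T; rewrite /= ?trmxK.
apply: continuous_compact; first by apply: continuous_subspaceT; exact: ct.
apply: bounded_closed_compact; last first.
  by move/continuous_closedP : ct; apply.
exists r; split => [|s rs x Ax /=]; first exact: num_real.
apply: norm_le_coord => [|i j].
  by rewrite (le_trans (normr_ge0 x^T))// (le_trans (Ar _ Ax))// ltW.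
have := coord_le_norm x^T j i; rewrite mxE => /le_trans; apply.
by rewrite (le_trans (Ar _ Ax))// ltW.
Qed.

Lemma closed_norm_le n (r : R) : closed [set x : 'cV[R]_n | `|x| <= r].
Proof.
by move/continuous_closedP : (@norm_continuous R 'cV[R]_n) => /(_ _ (@closed_le _ r)).
Qed.

Lemma closed_sphere n (r : R) : closed [set x : 'cV[R]_n | `|x| = r].
Proof.
by move/continuous_closedP : (@norm_continuous R 'cV[R]_n) => /(_ _ (@closed_eq _ r)).
Qed.

Lemma continuous_bounded_ball n (V : normedModType R) (F : 'cV[R]_n -> V) (r : R) :
  continuous F -> exists2 K : R, 0 <= K & forall x, `|x| <= r -> `|F x| <= K.
Proof.
move=> cF; have [r0|r0] := leP 0 r; last first.
  by exists 0 => // x xr; have := le_lt_trans (le_trans (normr_ge0 x) xr) r0; rewrite ltxx.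
have cpt : compact [set x : 'cV[R]_n | `|x| <= r].
  apply: compact_cV_bounded_closed; last exact: closed_norm_le.
  by exists r.
have [||c _ cmax] := @compact_EVT_max _ _ (fun x => `|F x|) _ _ cpt.
- by exists 0; rewrite /= normr0.
- apply: continuous_subspaceT => x; apply: (continuous_comp (cF x)).
  exact: norm_continuous.
by exists `|F c| => // x xr; apply: cmax; rewrite inE.
Qed.

Lemma norm_entry_bound m n (F : 'cV[R]_n -> 'cV[R]_m) (r : R) : continuous F ->
  exists2 K : R, 0 <= K & forall x i, `|x| <= r -> `|F x i 0| <= K.
Proof.
move=> /(continuous_bounded_ball r)[K K0 FK]; exists K => // x i xr.
exact: le_trans (coord_le_norm _ _ _) (FK _ xr).
Qed.

Lemma diff_coord m n (M v : 'M[R]_(m, n)) i j :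
  'd (fun N : 'M[R]_(m, n) => N i j : R) M v = v i j.
Proof.
have @f : {linear 'M[R]_(m, n) -> R}.
  by exists (fun N : 'M[R]_(_, _) => N i j); do 2![eexists]; do ?[constructor];
     rewrite ?mxE// => ? *; rewrite ?mxE//; move=> ?; rewrite !mxE.
by rewrite (_ : (fun _ => _) = f) // diff_lin//; exact: coord_continuous.
Qed.

Lemma cV_basis n (v : 'cV[R]_n) : v = \sum_j v j 0 *: delta_mx j 0.
Proof.
by rewrite {1}[v]matrix_sum_delta; apply: eq_bigr => j _; rewrite big_ord1.
Qed.

(** Mean value theorem for each coordinate along the segment from [a] to [b], which stays in the
    ball by convexity. The constant is the sum over [j] of bounds for the continuous partial
    derivatives on the ball. *)
Lemma C1_lipschitz_ball m n (F : 'cV[R]_n -> 'cV[R]_m) (r : R) : class_C 1 F ->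
  exists2 L : R, 0 <= L & forall a b, `|a| <= r -> `|b| <= r ->
    `|F b - F a| <= L * `|b - a|.
Proof.
move=> [dF cF].
have /choice[K KP] (j : 'I_n) : exists K : R, 0 <= K /\ forall x i, `|x| <= r ->
    `|'D_(delta_mx j 0) F x i 0| <= K.
  by have [K ? ?] := norm_entry_bound r (cF (delta_mx j 0)); exists K.
exists (\sum_j K j); first by apply: sumr_ge0 => j _; have [] := KP j.
move=> a b ar br; set v := b - a.
apply: norm_cV_le => [|i].
  by rewrite mulr_ge0// sumr_ge0// => j _; have [] := KP j.
pose c (t : R) := t *: v + a.
pose Fi := fun z => F z i 0.
have dFi z : differentiable Fi z.
  apply: (differentiable_comp (g := fun M : 'cV[R]_m => M i 0) (dF z)).
  exact: differentiable_coord.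
have c_shift (t h : R) : c (h *: 1 + t) = h *: v + c t.
  by rewrite /c scalerDl addrA /GRing.scale/= mulr1.
have dphi (t : R) : is_derive t 1 (Fi \o c) ('D_v F (c t) i 0).
  have -> : 'D_v F (c t) i 0 = 'D_v Fi (c t).
    rewrite !deriveE// (diff_comp (g := fun M : 'cV[R]_m => M i 0) (dF _))//=.
      by rewrite diff_coord.
    exact: differentiable_coord.
  (* The difference quotient of [Fi \o c] at [t] is literally that of [Fi] at [c t] in the direction
     [v], so the derivative is read off without a chain rule. *)
  have E : (fun h : R => h^-1 *: ((Fi \o c) (h *: 1 + t) - (Fi \o c) t)) =
           (fun h : R => h^-1 *: (Fi (h *: v + c t) - Fi (c t))).
    by apply/funext => h; rewrite /= c_shift.
  split; last by rewrite /derive -E.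
  have := @diff_derivable _ _ _ Fi (c t) v (dFi _).
  by rewrite /derivable -E.
have cphi : continuous (Fi \o c).
  by move=> t; apply/differentiable_continuous/derivable1_diffP; have /@ex_derive := dphi t.
have [z z01] := @MVT_segment _ (Fi \o c) _ 0 1 ler01 (fun t _ => dphi t)
  (continuous_subspaceT cphi).
rewrite subr0 mulr1 /= /c scale1r scale0r add0r /v subrK => E.
rewrite !mxE; rewrite /Fi in E; rewrite E.
have zr : `|z *: v + a| <= r.
  move: z01; rewrite in_itv/= => /andP[z0 z1].
  rewrite (_ : _ + _ = z *: b + (1 - z) *: a); last first.
    by rewrite /v scalerBr scalerBl scale1r -addrA (addrC (- _)).
  rewrite (le_trans (ler_normD _ _))// !normrZ !ger0_norm ?subr_ge0//.
  have : z * `|b| <= z * r by rewrite ler_wpM2l.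
  have : (1 - z) * `|a| <= (1 - z) * r by rewrite ler_wpM2l// subr_ge0.
  lra.
rewrite -/v; move: (z *: v + a) zr => p pr.
have -> : 'D_v F p i 0 = \sum_j v j 0 * 'D_(delta_mx j 0) F p i 0.
  rewrite deriveE// {1}(cV_basis v) linear_sum summxE.
  by apply: eq_bigr => j _; rewrite linearZ mxE deriveE.
rewrite (le_trans (ler_norm_sum _ _ _))// mulr_suml ler_sum// => j _.
rewrite normrM mulrC ler_pM//; last exact: coord_le_norm.
by have [_] := KP j; apply.
Qed.

Lemma class_C1_continuous m n (F : 'cV[R]_n -> 'cV[R]_m) : class_C 1 F -> continuous F.
Proof. by move=> [dF _] x; exact: differentiable_continuous. Qed.

Lemma continuous_sum (T : topologicalType) (I : Type) (s : seq I) (h : I -> T -> R) :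
  (forall i, continuous (h i)) -> continuous (fun x => \sum_(i <- s) h i x).
Proof.
move=> ch; elim: s => [|i s IH] x.
  rewrite (_ : (fun _ => _) = cst 0); first exact: cst_continuous.
  by apply/funext => y; rewrite big_nil.
rewrite (_ : (fun _ => _) = fun y => h i y + \sum_(j <- s) h j y); last first.
  by apply/funext => y; rewrite big_cons.
by apply: cvgD; [exact: ch|exact: IH].
Qed.

Lemma continuous_mulr (T : topologicalType) (h k : T -> R) :
  continuous h -> continuous k -> continuous (fun x => h x * k x).
Proof. by move=> ch ck x; apply: cvgM; [exact: ch|exact: ck]. Qed.

End VectorNorm.

Section QuadraticForm.
Context {R : realType} {n : nat}.
Variable P : 'M[R]_n.
Implicit Types x y : 'cV[R]_n.

Lemma quadformE x : quadform P x = \sum_j \sum_i x i 0 * P i j * x j 0.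
Proof.
rewrite /quadform mxE; apply: eq_bigr => j _; rewrite mxE mulr_suml.
by apply: eq_bigr => i _; rewrite mxE.
Qed.

(** Telescoping y_i y_j - x_i x_j = (y - x)_i y_j + x_i (y - x)_j. It serves twice: to compare costs
    of nearby trajectories on [0, T], and, with [x = 0], to bound the cost density by K |y|^2 on the
    tail. *)
Lemma quadform_dist : exists2 K : R, 0 <= K & forall x y,
  `|quadform P y - quadform P x| <= K * (`|y - x| * (`|y| + `|x|)).
Proof.
exists (\sum_j \sum_i `|P i j|).
  by apply: sumr_ge0 => j _; apply: sumr_ge0.
move=> x y; rewrite !quadformE -sumrB mulr_suml (le_trans (ler_norm_sum _ _ _))//.
apply: ler_sum => j _; rewrite -sumrB mulr_suml (le_trans (ler_norm_sum _ _ _))//.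
apply: ler_sum => i _.
have -> : y i 0 * P i j * y j 0 - x i 0 * P i j * x j 0 =
    P i j * ((y - x) i 0 * y j 0 + x i 0 * (y - x) j 0) by rewrite !mxE; ring.
rewrite normrM ler_wpM2l// (le_trans (ler_normD _ _))// !normrM mulrDr.
by rewrite lerD// 1?[`|y - x| * `|x|]mulrC; apply: ler_pM => //; apply: coord_le_norm.
Qed.

Lemma quadform0 : quadform P 0 = 0.
Proof. by rewrite /quadform mulmx0 mxE. Qed.

Lemma quadformZ (a : R) x : quadform P (a *: x) = a ^+ 2 * quadform P x.
Proof.
rewrite !quadformE mulr_sumr; apply: eq_bigr => j _; rewrite mulr_sumr.
by apply: eq_bigr => i _; rewrite !mxE; ring.
Qed.

Lemma continuous_quadform : continuous (quadform P).
Proof.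
move=> x; rewrite (_ : quadform P = fun x => \sum_j \sum_i x i 0 * P i j * x j 0); last first.
  by apply/funext => y; exact: quadformE.
apply: continuous_sum => j; apply: continuous_sum => i.
apply: continuous_mulr; last exact: coord_continuous.
by apply: continuous_mulr; [exact: coord_continuous|exact: cst_continuous].
Qed.

(** The constant is the minimum of the form on the unit sphere, positive by compactness; homogeneity
    of degree 2 does the rest. *)
Lemma quadform_ge : sym_posdef P -> exists2 c : R, 0 < c & forall x,
  c * `|x| ^+ 2 <= quadform P x.
Proof.
move=> [_ P0].
(* An empty sphere, as in dimension 0, has no minimizer; then every vector is zero and any constant
   works. *)
have [S0|/set0P S0] := eqVneq [set x : 'cV[R]_n | `|x| = 1] set0.
  exists 1 => // x; have [->|x0] := eqVneq x 0.
    by rewrite quadform0 normr0 expr0n mulr0.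
  have : [set x : 'cV[R]_n | `|x| = 1] (`|x|^-1 *: x).
    by rewrite /= normrZ normfV normr_id mulVf// normr_eq0.
  by rewrite S0.
have cS : compact [set x : 'cV[R]_n | `|x| = 1].
  apply: compact_cV_bounded_closed; last exact: closed_sphere.
  by exists 1 => x ->.
have [|c cS1 cmin] := @compact_EVT_min _ _ (quadform P) _ S0 cS.
  by apply: continuous_subspaceT; exact: continuous_quadform.
exists (quadform P c).
  by apply: P0; rewrite -normr_gt0; move: cS1; rewrite inE/= => ->.
move=> x; have [->|x0] := eqVneq x 0.
  by rewrite quadform0 normr0 expr0n mulr0.
have x0' : `|x| != 0 by rewrite normr_eq0.
rewrite {2}(_ : x = `|x| *: (`|x|^-1 *: x)); last by rewrite scalerA mulfV// scale1r.
rewrite quadformZ mulrC ler_wpM2l ?sqr_ge0//; apply: cmin.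
by rewrite inE/= normrZ normfV normr_id mulVf.
Qed.

End QuadraticForm.

(** * Integral equations with integrable Lipschitz constant *)

Section GeometricLimits.
Context {R : realType}.
Implicit Types (u : nat -> R).

(** Passage to the limit in explicit estimates: it removes the error terms of order 2^-j left after
    j rounds of an iteration. *)
Lemma le0_of_geometric (r C : R) : (forall j : nat, r <= C / 2 ^+ j) -> r <= 0.
Proof.
move=> rC; apply/ler_addgt0Pr => e e0; rewrite add0r.
pose j := (Num.truncn (`|C| / e)).+1; apply: le_trans (rC j) _.
have Ce : `|C| / e < 2 ^+ j.
  apply: lt_le_trans (truncnS_gt _) _; rewrite -/j -natrX ler_nat.
  by rewrite ltnW// ltn_expl.
rewrite ler_pdivrMr ?exprn_gt0// (le_trans (ler_norm C))//.
by move: Ce; rewrite ltr_pdivrMr// mulrC => /ltW.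
Qed.

(* The bounds [u j -+ 2 B / 2 ^ j] are nested, so the supremum of the lower ones
   is a limit of u with an explicit rate. *)
Lemma geometric_cauchy u (B : R) : (forall j, `|u j.+1 - u j| <= B / 2 ^+ j) ->
  exists L : R, forall j, `|L - u j| <= 2 * B / 2 ^+ j.
Proof.
move=> uB; pose d j := 2 * B / 2 ^+ j.
have dS j : B / 2 ^+ j = d j - d j.+1 by rewrite /d exprS; field; rewrite expf_neq0.
have d0 j : 0 <= d j.
  have B0 : 0 <= B by have := uB 0; rewrite expr0 divr1; apply: le_trans.
  by rewrite /d mulr_ge0 ?mulr_ge0// invr_ge0 exprn_ge0.
have lo : {homo (fun j => u j - d j) : i j / (i <= j)%N >-> i <= j}.
  apply/nondecreasing_seqP => j; have := uB j; rewrite ler_norml dS => /andP[]; lra.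
have hi : {homo (fun j => u j + d j) : i j / (i <= j)%N >-> j <= i}.
  apply/nonincreasing_seqP => j; have := uB j; rewrite ler_norml dS => /andP[]; lra.
have lohi i j : u i - d i <= u j + d j.
  have := lo _ _ (leq_maxl i j); have := hi _ _ (leq_maxr i j).
  have := d0 (maxn i j); lra.
exists (sup (range (fun j => u j - d j))) => j.
have ub i : ubound (range (fun j => u j - d j)) (u i + d i) by move=> _ [k _ <-].
have : sup (range (fun j => u j - d j)) <= u j + d j.
  by apply: ge_sup => //; exists (u 0 - d 0); exists 0.
have : u j - d j <= sup (range (fun j => u j - d j)).
  by apply: ub_le_sup; [exists (u 0 + d 0); exact: ub|exists j].
by rewrite ler_norml -/(d j) => ? ?; apply/andP; split; lra.
Qed.

End GeometricLimits.

Section VectorIntegrals.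
Context {R : realType}.

Lemma within_continuous_bounded n (T : R) (y : R -> 'cV[R]_n) : 0 <= T ->
  {within `[0, T], continuous y} ->
  exists2 K : R, 0 <= K & forall t, 0 <= t <= T -> `|y t| <= K.
Proof.
move=> T0 cy; have [|c _ cmax] := @EVT_max R (fun t => `|y t|) 0 T T0.
  move=> t; have := cy t.
  by move=> /(@cvg_comp _ _ _ _ (@Num.norm _ _)); apply; exact: norm_continuous.
by exists `|y c| => // t tT; apply: cmax; rewrite in_itv.
Qed.

Lemma integrable_prefix (T t : R) (h : R -> R) : t <= T ->
  mu.-integrable `[0, T] (EFin \o h) -> mu.-integrable `[0, t] (EFin \o h).
Proof.
by move=> tT; apply: integrableS => //; apply: subset_itvl; rewrite bnd_simp.
Qed.

Lemma integrable_subr (D : set R) (h k : R -> R) : measurable D ->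
  mu.-integrable D (EFin \o h) -> mu.-integrable D (EFin \o k) ->
  mu.-integrable D (EFin \o (fun s => h s - k s)).
Proof. by move=> mD ih ik; exact: (integrableB _ ih ik). Qed.

Lemma integrable_addr (D : set R) (h k : R -> R) : measurable D ->
  mu.-integrable D (EFin \o h) -> mu.-integrable D (EFin \o k) ->
  mu.-integrable D (EFin \o (fun s => h s + k s)).
Proof. by move=> mD ih ik; exact: (integrableD _ ih ik). Qed.

(** An a priori bound on [phi] is improved again and again: inserted in the integral, its excess
    over the contribution of [eta] is halved each time by the weighted kernel estimate. [K] depends
    on [l] and [T] alone, which allows [eta] to be made small after [K] is known. *)
Lemma gronwall (l : R -> R) (T : R) : 0 <= T ->
  mu.-integrable `[0, T] (EFin \o l) ->
  exists2 K : R, 0 <= K & forall n (phi h : R -> 'cV[R]_n) (eta : R),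
    {within `[0, T], continuous phi} ->
    (forall i, mu.-integrable `[0, T] (EFin \o (fun s => h s i 0))) ->
    (forall s, 0 <= s <= T -> `|h s| <= `|l s| * `|phi s|) ->
    (forall t i, 0 <= t <= T ->
      `|phi t i 0 - \int[mu]_(s in `[0, t]) h s i 0| <= eta) -> 0 <= eta ->
    forall t, 0 <= t <= T -> `|phi t| <= K * eta.
Proof.
move=> T0 il; have [a a0 ker] := weighted_kernel il.
have e1 t : 0 <= t -> 1 <= expR (a * t).
  by move=> t0; rewrite -expR0 ler_expR mulr_ge0// ltW.
exists (2 * expR (a * T)); first by rewrite mulr_ge0// expR_ge0.
move=> n phi h eta cphi ih hl hphi eta0.
have [W W0 phiW] := within_continuous_bounded T0 cphi.
(* [2 * eta] is the fixed point of s = eta + s / 2, the recursion undergone by the coefficient of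
   the weight; [W] is the initial bound of [|phi|]. *)
have iterW (j : nat) t : 0 <= t <= T ->
    `|phi t| <= (2 * eta + W / 2 ^+ j) * expR (a * t).
  elim: j t => [|j IH] t /andP[t0 tT].
    rewrite expr0 divr1 (le_trans (phiW t _)) ?t0// (@le_trans _ _ (2 * eta + W))//.
      by rewrite lerDr mulr_ge0.
    by rewrite ler_peMr ?e1// addr_ge0// mulr_ge0.
  have Wj0 : 0 <= W / 2 ^+ j by rewrite mulr_ge0// invr_ge0 exprn_ge0.
  have E0 := e1 t t0.
  have W2 : W / 2 ^+ j.+1 = W / 2 ^+ j / 2 by rewrite exprS invfM mulrCA mulrC.
  apply: norm_cV_le => [|i].
    by rewrite mulr_ge0 ?expR_ge0// addr_ge0// ?mulr_ge0// invr_ge0 exprn_ge0.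
  have kt : `|\int[mu]_(s in `[0, t]) h s i 0| <=
      (2 * eta + W / 2 ^+ j) / 2 * expR (a * t).
    apply: ker; first by rewrite t0.
    - by rewrite addr_ge0// mulr_ge0.
    - exact: integrable_prefix (ih i).
    - move=> s /andP[s0 st]; rewrite (le_trans (coord_le_norm _ _ _))//.
      have sT : 0 <= s <= T by rewrite s0 (le_trans st).
      by rewrite (le_trans (hl s sT))// ler_wpM2l// IH.
  rewrite -[phi t i 0](subrK (\int[mu]_(s in `[0, t]) h s i 0)).
  apply: le_trans (ler_normD _ _) _.
  have := hphi t i; rewrite t0 tT => /(_ isT) H.
  rewrite W2; have : eta <= eta * expR (a * t) by rewrite ler_peMr.
  by move: H kt; lra.
move=> t tT; have /andP[t0 t1] := tT; rewrite -subr_le0.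
apply: (@le0_of_geometric _ _ (W * expR (a * T))) => j.
rewrite lerBlDr (le_trans (iterW j t tT))//.
have : expR (a * t) <= expR (a * T) by rewrite ler_expR ler_wpM2l// ltW.
have Wj0 : 0 <= W / 2 ^+ j by rewrite mulr_ge0// invr_ge0 exprn_ge0.
move=> /(ler_wpM2l (_ : 0 <= 2 * eta + W / 2 ^+ j)) => /(_ _)/le_trans; apply.
  by rewrite addr_ge0// mulr_ge0.
by rewrite mulrDl addrC lerD//; [rewrite mulrAC|rewrite mulrAC].
Qed.

Lemma continuous_integral_col n (T : R) (h : R -> 'cV[R]_n) (x0 : 'cV[R]_n) :
  0 <= T -> (forall i, mu.-integrable `[0, T] (EFin \o (fun s => h s i 0))) ->
  {within `[0, T], continuous
     (fun t => \col_i (x0 i 0 + \int[mu]_(s in `[0, t]) h s i 0))}.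
Proof.
move=> T0 ih; apply: within_continuous_cV => i.
rewrite (_ : (fun t => _) = cst (x0 i 0) + (fun t => \int[mu]_(s in `[0, t]) h s i 0)).
  apply: within_continuousD; last exact: parameterized_integral_continuous.
  by apply: continuous_subspaceT; exact: cst_continuous.
by apply/funext => t; rewrite mxE.
Qed.

(* Picard iteration; the factor 1/2 of [weighted_kernel] makes the iterates
   converge geometrically. *)
Lemma caratheodory_existence n (T : R) (l : R -> R) (F : R -> 'cV[R]_n -> 'cV[R]_n)
    (x0 : 'cV[R]_n) : 0 <= T ->
  mu.-integrable `[0, T] (EFin \o l) ->
  (forall s a b, 0 <= s <= T -> `|F s a - F s b| <= `|l s| * `|a - b|) ->
  (forall y : R -> 'cV[R]_n, {within `[0, T], continuous y} -> forall i,
    mu.-integrable `[0, T] (EFin \o (fun s => F s (y s) i 0))) ->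
  exists2 y : R -> 'cV[R]_n, {within `[0, T], continuous y} &
    forall t i, 0 <= t <= T ->
      y t i 0 = x0 i 0 + \int[mu]_(s in `[0, t]) F s (y s) i 0.
Proof.
move=> T0 il Fl iF; have [a a0 ker] := weighted_kernel il.
pose Phi (y : R -> 'cV[R]_n) t : 'cV[R]_n :=
  \col_i (x0 i 0 + \int[mu]_(s in `[0, t]) F s (y s) i 0).
pose y_ j := iter j Phi (cst x0).
have cy_ j : {within `[0, T], continuous (y_ j)}.
  elim: j => [|j IH]; first by apply: continuous_subspaceT; exact: cst_continuous.
  by apply: continuous_integral_col => //; exact: iF.
(* [Phi] contracts by 1/2 in the sup norm weighted by e^(-a t). *)
have PhiB (y z : R -> 'cV[R]_n) t W : {within `[0, T], continuous y} ->
    {within `[0, T], continuous z} -> 0 <= t <= T -> 0 <= W ->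
    (forall s, 0 <= s <= T -> `|y s - z s| <= W * expR (a * s)) ->
    `|Phi y t - Phi z t| <= W / 2 * expR (a * t).
  move=> cy cz tT W0 yz; have /andP[t0 t1] := tT.
  apply: norm_cV_le => [|i]; first by rewrite mulr_ge0 ?expR_ge0// divr_ge0.
  rewrite !mxE opprD addrACA subrr add0r -RintegralB//; last 2 first.
  - exact: integrable_prefix (iF _ cy i).
  - exact: integrable_prefix (iF _ cz i).
  apply: ker => //.
    by apply: integrable_subr => //; apply: integrable_prefix t1 _; exact: iF.
  move=> s /andP[s0 st]; have sT : 0 <= s <= T by rewrite s0 (le_trans st).
  have := coord_le_norm (F s (y s) - F s (z s)) i 0; rewrite !mxE => /le_trans; apply.
  by rewrite (le_trans (Fl _ _ _ sT))// ler_wpM2l// yz.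
have [A A0 yA] : exists2 A : R, 0 <= A & forall t, 0 <= t <= T ->
    `|y_ 1%N t - y_ 0%N t| <= A.
  apply: (@within_continuous_bounded n T (fun t => y_ 1%N t - y_ 0%N t)) => //.
  exact: within_continuousB (cy_ 1%N) (cy_ 0%N).
have e1 t : 0 <= t -> 1 <= expR (a * t).
  by move=> t0; rewrite -expR0 ler_expR mulr_ge0// ltW.
have eT t : t <= T -> expR (a * t) <= expR (a * T).
  by move=> tT; rewrite ler_expR ler_wpM2l// ltW.
have y_S (j : nat) t : 0 <= t <= T ->
    `|y_ j.+1 t - y_ j t| <= A / 2 ^+ j * expR (a * t).
  elim: j t => [|j IH] t tT.
    rewrite expr0 divr1 (le_trans (yA t tT))// ler_peMr// e1//.
    by case/andP: tT.
  have -> : A / 2 ^+ j.+1 = A / 2 ^+ j / 2 by rewrite exprS invfM mulrCA mulrC.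
  apply: (PhiB _ _ _ _ (cy_ j.+1) (cy_ j)) => //.
  by rewrite mulr_ge0// invr_ge0 exprn_ge0.
set B := A * expR (a * T).
have B0 : 0 <= B by rewrite mulr_ge0// expR_ge0.
(* The limit is taken coordinatewise and pointwise, but the rate does not depend on [t], so the
   convergence is uniform on [0, T]; outside, [0] is a default value. *)
have /choice[Y YP] (t : R) : exists Y : 'cV[R]_n, 0 <= t <= T ->
    forall j, `|Y - y_ j t| <= 2 * B / 2 ^+ j.
  have [tT|] := boolP (0 <= t <= T); last by exists 0.
  have /choice[Y YP] (i : 'I_n) : exists L : R, forall j,
      `|L - y_ j t i 0| <= 2 * B / 2 ^+ j.
    apply: (@geometric_cauchy _ (fun j => y_ j t i 0)) => j.
    have := coord_le_norm (y_ j.+1 t - y_ j t) i 0; rewrite !mxE => /le_trans; apply.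
    rewrite (le_trans (y_S j t tT))// /B mulrAC ler_wpM2r ?invr_ge0 ?exprn_ge0//.
    by rewrite ler_wpM2l// eT//; case/andP: tT.
  exists (\col_i Y i) => _ j; apply: norm_cV_le => [|i]; last by rewrite !mxE.
  by rewrite mulr_ge0 ?mulr_ge0// invr_ge0 exprn_ge0.
have cY : {within `[0, T], continuous Y}.
  apply/subspace_continuousP => t tT'.
  have tT : 0 <= t <= T by move: tT'; rewrite /= in_itv.
  apply/cvgrPdist_le => e e0.
  have [j jP] : exists j : nat, 2 * B / 2 ^+ j <= e / 3.
    apply: contrapT => /forallNP H.
    have : e / 3 <= 0.
      by apply: (@le0_of_geometric _ _ (2 * B)) => j; have /negP := H j; rewrite -ltNge => /ltW.
    lra.
  move/subspace_continuousP : (cy_ j) => /(_ t tT')/cvgrPdist_le /(_ (e / 3)).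
  have e3 : 0 < e / 3 by lra.
  move=> /(_ e3) H; near=> s.
  have sT : 0 <= s <= T.
    suff : `[0, T]%classic s by rewrite /= in_itv.
    by near: s; exact: withinT.
  have -> : Y t - Y s = (Y t - y_ j t) + (y_ j t - y_ j s) + (y_ j s - Y s).
    by apply/matrixP => p q; rewrite !mxE; ring.
  have hts : `|y_ j t - y_ j s| <= e / 3 by near: s.
  have := le_trans (YP t tT j) jP; have := le_trans (YP s sT j) jP.
  rewrite [`|Y s - _|]distrC.
  have := ler_normD (Y t - y_ j t + (y_ j t - y_ j s)) (y_ j s - Y s).
  have := ler_normD (Y t - y_ j t) (y_ j t - y_ j s).
  lra.
exists Y => // t i tT.
suff : `|Y t - Phi Y t| <= 0.
  by rewrite normr_le0 subr_eq0 => /eqP ->; rewrite mxE.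
(* [Y] and [Phi Y] are both within O(2^-j) of the iterate [y_ j.+1], the first by the rate of
   convergence, the second by contraction. *)
apply: (@le0_of_geometric _ _ (2 * B + B * expR (a * T))) => j.
have bj : 0 <= B / 2 ^+ j by rewrite mulr_ge0// invr_ge0 exprn_ge0.
have H1 : `|Y t - y_ j.+1 t| <= 2 * B / 2 ^+ j.
  apply: le_trans (YP t tT j.+1) _.
  by rewrite exprS invfM mulrCA; move: bj; lra.
have H2 : `|y_ j.+1 t - Phi Y t| <= 2 * B / 2 ^+ j / 2 * expR (a * t).
  apply: PhiB => //; first by move: bj; lra.
  move=> s sT; rewrite distrC (le_trans (YP s sT j))// ler_peMr ?e1//.
    by move: bj; lra.
  by case/andP: sT.
have -> : Y t - Phi Y t = (Y t - y_ j.+1 t) + (y_ j.+1 t - Phi Y t).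
  by apply/matrixP => p q; rewrite !mxE; ring.
apply: le_trans (ler_normD _ _) _.
have : B / 2 ^+ j * expR (a * t) <= B / 2 ^+ j * expR (a * T).
  by rewrite ler_wpM2l// eT//; case/andP: tT.
by move: H1 H2; lra.
Unshelve. all: by end_near. Qed.

End VectorIntegrals.

(** * Control-affine systems with truncated controls *)

Section ControlAffine.
Context {R : realType} {n k : nat}.
Implicit Types (f : 'cV[R]_n -> 'cV[R]_n) (G : 'cV[R]_n -> 'M[R]_(n, k)).
Implicit Types (x y : R -> 'cV[R]_n) (u v : R -> 'cV[R]_k).

Definition velocity f G (z : 'cV[R]_n) (w : 'cV[R]_k) : 'cV[R]_n := f z + G z *m w.

Definition lipschitz_on_balls f G := forall r : R, exists2 L : R, 0 <= L &
  forall a b : 'cV[R]_n, `|a| <= r -> `|b| <= r ->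
    `|f a - f b| <= L * `|a - b| /\ forall i j, `|G a i j - G b i j| <= L * `|a - b|.

Definition continuous_system f G :=
  continuous f /\ forall i j, continuous (fun z => G z i j).

(** The l1 norm matches entrywise bounds on [G]: a coordinate of [G z *m w] is at most the largest
    entry times [absum w]. This gives the Lipschitz kernel [L * (1 + absum (u s))]. *)
Definition absum (w : 'cV[R]_k) : R := \sum_j `|w j 0|.

Lemma absum_ge0 w : 0 <= absum w.
Proof. exact: sumr_ge0. Qed.

Lemma velocity_lipschitz f G (L : R) (a b : 'cV[R]_n) (w : 'cV[R]_k) : 0 <= L ->
  `|f a - f b| <= L * `|a - b| ->
  (forall i j, `|G a i j - G b i j| <= L * `|a - b|) ->
  `|velocity f G a w - velocity f G b w| <= L * (1 + absum w) * `|a - b|.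
Proof.
move=> L0 fab Gab; apply: norm_cV_le => [|i].
  by rewrite mulr_ge0// mulr_ge0// addr_ge0// absum_ge0.
have -> : (velocity f G a w - velocity f G b w) i 0 =
    (f a - f b) i 0 + \sum_j (G a i j - G b i j) * w j 0.
  rewrite !mxE opprD addrACA; congr (_ + _); rewrite -sumrB.
  by apply: eq_bigr => j _; rewrite mulrBl.
rewrite (le_trans (ler_normD _ _))// mulrDr mulr1 mulrDl lerD//.
  exact: le_trans (coord_le_norm _ _ _) fab.
rewrite (le_trans (ler_norm_sum _ _ _))// mulrAC mulr_sumr ler_sum// => j _.
by rewrite normrM ler_wpM2r.
Qed.

Lemma velocity_control_dist f G (M : R) (z : 'cV[R]_n) (w w' : 'cV[R]_k) i :
  (forall j, `|G z i j| <= M) ->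
  `|velocity f G z w i 0 - velocity f G z w' i 0| <= M * absum (w - w').
Proof.
move=> GM.
have -> : velocity f G z w i 0 - velocity f G z w' i 0 =
    \sum_j G z i j * (w - w') j 0.
  rewrite !mxE opprD addrACA subrr add0r -sumrB.
  by apply: eq_bigr => j _; rewrite !mxE mulrBr.
rewrite (le_trans (ler_norm_sum _ _ _))// mulr_sumr ler_sum// => j _.
by rewrite normrM ler_wpM2r.
Qed.

Lemma integrable_sum_fin (I : finType) (D : set R) (h : I -> R -> R) : measurable D ->
  (forall j, mu.-integrable D (EFin \o h j)) ->
  mu.-integrable D (EFin \o (fun s => \sum_j h j s)).
Proof.
move=> mD ih; rewrite (_ : _ \o _ = fun s => (\sum_j (EFin \o h j) s)%E); last first.
  by apply/funext => s /=; rewrite sumEFin.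
exact: integrable_sum.
Qed.

Lemma Rintegral_sum_fin (I : finType) (D : set R) (h : I -> R -> R) : measurable D ->
  (forall j, mu.-integrable D (EFin \o h j)) ->
  \int[mu]_(s in D) (\sum_j h j s) = \sum_j \int[mu]_(s in D) h j s.
Proof.
move=> mD ih; rewrite /Rintegral.
under eq_integral do rewrite -sumEFin.
rewrite integral_sum// (_ : (\sum_j _)%E =
    (\sum_j (fine (\int[mu]_(s in D) (h j s)%:E))%:E)%E); last first.
  by apply: eq_bigr => j _; rewrite fineK//; exact: integrable_fin_num (ih j).
by rewrite sumEFin.
Qed.

Lemma integrable_mull (D : set R) (c : R) (h : R -> R) : measurable D ->
  mu.-integrable D (EFin \o h) -> mu.-integrable D (EFin \o (fun s => c * h s)).
Proof. by move=> mD ih; exact: (integrableZl _ c ih). Qed.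

Lemma integrable_const_itv (a b c : R) :
  mu.-integrable `[a, b] (EFin \o (fun=> c)).
Proof.
apply: continuous_compact_integrable; first exact: segment_compact.
by apply: continuous_subspaceT; exact: cst_continuous.
Qed.

Lemma integrable_absum (T : R) u :
  (forall j, mu.-integrable `[0, T] (EFin \o (fun s => u s j 0))) ->
  mu.-integrable `[0, T] (EFin \o (fun s => absum (u s))).
Proof.
by move=> iu; apply: integrable_sum_fin => // j; exact: (integrable_norm (iu j)).
Qed.

Lemma integrable_lipschitz_kernel (T L : R) u :
  (forall j, mu.-integrable `[0, T] (EFin \o (fun s => u s j 0))) ->
  mu.-integrable `[0, T] (EFin \o (fun s => L * (1 + absum (u s)))).
Proof.
move=> iu; apply: integrable_mull => //; apply: integrable_addr => //.
  exact: integrable_const_itv.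
exact: integrable_absum.
Qed.

(** Along a continuous curve the coefficients are bounded on the compact interval, and a bounded
    measurable factor preserves integrability of the control. *)
Lemma integrable_velocity f G (T : R) y u i : continuous_system f G -> 0 <= T ->
  {within `[0, T], continuous y} ->
  (forall j, mu.-integrable `[0, T] (EFin \o (fun s => u s j 0))) ->
  mu.-integrable `[0, T] (EFin \o (fun s => velocity f G (y s) (u s) i 0)).
Proof.
move=> [cf cG] T0 cy iu.
rewrite (_ : _ \o _ = EFin \o
    (fun s => f (y s) i 0 + \sum_j G (y s) i j * u s j 0)); last first.
  by apply/funext => s /=; rewrite !mxE.
apply: integrable_addr => //.
  apply: continuous_compact_integrable; first exact: segment_compact.
  apply: (@within_continuous_coord _ _ _ (f \o y)).
  exact: within_continuous_comp_cV.
apply: integrable_sum_fin => // j.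
have cGy : {within `[0, T], continuous (fun s => G (y s) i j)}.
  exact: (@within_continuous_comp_cV _ _ _ _ y (fun z => G z i j)).
apply: (@integrableMr _ _ _ mu _ _ (fun s => G (y s) i j)) (iu j) => //.
  exact: subspace_continuous_measurable_fun.
have [K K0 yK] := within_continuous_bounded T0 cy.
have [M M0 GM] := continuous_bounded_ball K (cG i j).
exists M; split; first exact: num_real.
move=> M' MM' s /= sT; apply: le_trans (ltW MM'); apply: GM; apply: yK.
by move: sT; rewrite in_itv.
Qed.

Definition solution_on f G (T : R) (z0 : 'cV[R]_n) u x :=
  {within `[0, T], continuous x} /\
  forall (t : R) i, 0 <= t <= T ->
    x t i 0 = z0 i 0 + \int[mu]_(s in `[0, t]) velocity f G (x s) (u s) i 0.

(** Gronwall with [eta = 0]. Both solutions are bounded on [0, T], so the Lipschitz constant of one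
    common ball is enough. *)
Lemma solution_on_unique f G (T : R) z0 u x y : lipschitz_on_balls f G ->
  continuous_system f G -> 0 <= T ->
  (forall j, mu.-integrable `[0, T] (EFin \o (fun s => u s j 0))) ->
  solution_on f G T z0 u x -> solution_on f G T z0 u y ->
  forall t, 0 <= t <= T -> x t = y t.
Proof.
move=> lfG cfG T0 iu [cx xE] [cy yE].
have [K1 K10 xK1] := within_continuous_bounded T0 cx.
have [K2 K20 yK2] := within_continuous_bounded T0 cy.
have [L L0 LP] := lfG (Num.max K1 K2).
have [K K0 KP] := gronwall T0 (integrable_lipschitz_kernel L iu).
have ix i := integrable_velocity i cfG T0 cx iu.
have iy i := integrable_velocity i cfG T0 cy iu.
move=> t tT; apply/eqP; rewrite -subr_eq0 -normr_le0.
have := KP n (fun s => x s - y s)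
  (fun s => velocity f G (x s) (u s) - velocity f G (y s) (u s)) 0.
rewrite mulr0; apply => //.
- exact: (within_continuousB cx cy).
- move=> i; rewrite (_ : _ \o _ = EFin \o (fun s => velocity f G (x s) (u s) i 0 -
    velocity f G (y s) (u s) i 0)); first exact: integrable_subr.
  by apply/funext => s; rewrite /= cV_subE.
- move=> s sT.
  have xr : `|x s| <= Num.max K1 K2 by rewrite le_max xK1.
  have yr : `|y s| <= Num.max K1 K2 by rewrite le_max yK2// orbT.
  have [fL GL] := LP (x s) (y s) xr yr.
  rewrite [X in X * _]ger0_norm; last by rewrite mulr_ge0// addr_ge0// absum_ge0.
  exact: velocity_lipschitz.
- move=> r i rT; have /andP[_ r1] := rT.
  rewrite cV_subE xE// yE// opprD addrACA subrr add0r.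
  rewrite -RintegralB//; try exact: integrable_prefix (ix i); try exact: integrable_prefix (iy i).
  rewrite normr_le0 subr_eq0; apply/eqP; apply: eq_Rintegral => s _.
  by rewrite cV_subE.
Qed.

End ControlAffine.

Section Truncation.
Context {R : realType} {n k : nat}.

Definition clipv m (M : R) (z : 'cV[R]_m) : 'cV[R]_m := \col_i clip M (z i 0).

Lemma norm_clipv m (M : R) (z : 'cV[R]_m) : 0 <= M -> `|clipv M z| <= M.
Proof. by move=> M0; apply: norm_cV_le => // i; rewrite mxE normr_clip. Qed.

Lemma clipv_id m (M : R) (z : 'cV[R]_m) : `|z| <= M -> clipv M z = z.
Proof.
move=> zM; apply/colP => i; rewrite mxE clip_id//.
exact: le_trans (coord_le_norm _ _ _) zM.
Qed.

Lemma clipv_lipschitz m (M : R) (z w : 'cV[R]_m) : 0 <= M ->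
  `|clipv M z - clipv M w| <= `|z - w|.
Proof.
move=> M0; apply: norm_cV_le => // i; rewrite !mxE (le_trans (clip_lipschitz _ _ M0))//.
by have := coord_le_norm (z - w) i 0; rewrite !mxE.
Qed.

Lemma continuous_clipv m (M : R) : continuous (@clipv m M).
Proof.
move=> z; apply: (@cvg_cV _ _ _ (nbhs_filter z)) => i.
rewrite (_ : (fun _ => _) = fun w : 'cV[R]_m => clip M (w i 0)); last first.
  by apply/funext => w; rewrite mxE.
rewrite mxE; apply: (@continuous_comp _ _ _ (fun w : 'cV[R]_m => w i 0) (clip M)).
  exact: coord_continuous.
exact: continuous_clip.
Qed.

(* The truncated control is first fed to the system frozen outside the ball of
   radius K + e: Gronwall's bound then shows that the resulting trajectory
   never leaves that ball. *)
Lemma bounded_control_approx (f : 'cV[R]_n -> 'cV[R]_n) (G : 'cV[R]_n -> 'M[R]_(n, k))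
    (T : R) z0 (u : R -> 'cV[R]_k) (x : R -> 'cV[R]_n) (e : R) :
  lipschitz_on_balls f G -> continuous_system f G -> 0 <= T -> 0 < e ->
  (forall j, mu.-integrable `[0, T] (EFin \o (fun s => u s j 0))) ->
  solution_on f G T z0 u x ->
  exists (M : R) (v : R -> 'cV[R]_k) (y : R -> 'cV[R]_n),
    [/\ forall t, `|v t| <= M,
        forall j, measurable_fun `[0, T] (fun s => v s j 0),
        solution_on f G T z0 v y &
        forall t, 0 <= t <= T -> `|y t - x t| <= e].
Proof.
move=> lfG [cf cG] T0 e0 iu [cx xE].
have [K1 K10 xK] := within_continuous_bounded T0 cx.
set r := K1 + e; have r0 : 0 <= r by rewrite addr_ge0// ltW.
have [L L0 LP] := lfG r.
have [K K0 KP] := gronwall T0 (integrable_lipschitz_kernel L iu).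
have [C C0 CP] : exists2 C : R, 0 <= C & forall z i j, `|z| <= r -> `|G z i j| <= C.
  have /choice[C CP] (ij : 'I_n * 'I_k) : exists C : R, 0 <= C /\
      forall z, `|z| <= r -> `|G z ij.1 ij.2| <= C.
    by have [C ? ?] := continuous_bounded_ball r (cG ij.1 ij.2); exists C.
  exists (\sum_ij C ij); first by apply: sumr_ge0 => ij _; have [] := CP ij.
  move=> z i j zr; rewrite (le_trans ((CP (i, j)).2 z zr))//.
  rewrite (bigD1 (i, j))//= lerDl; apply: sumr_ge0 => ij _.
  by have [] := CP ij.
(* [d] is the L1 error allowed for each of the [k] components. The total perturbation is
   [C * k * d], amplified by [K], and must stay below [e]; the added units keep the denominator
   positive when [k], [C] or [K] vanishes. *)
set d := e / (K * (C * (k%:R + 1)) + 1).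
have den0 : 0 < K * (C * (k%:R + 1)) + 1 by rewrite ltr_wpDl// !mulr_ge0// addr_ge0.
have d0 : 0 < d by rewrite divr_gt0.
have /choice[M MP] (j : 'I_k) : exists M : R, 0 < M /\
    \int[mu]_(s in `[0, T]) `|u s j 0 - clip M (u s j 0)| <= d.
  by have [//|M ? ?] := clip_L1_approx d0 _ (iu j); exists M.
have M0 j : 0 <= M j by have [/ltW] := MP j.
pose v s : 'cV[R]_k := \col_j clip (M j) (u s j 0).
have vM t : `|v t| <= \sum_j M j.
  apply: norm_cV_le => [|j]; first exact: sumr_ge0.
  rewrite mxE (le_trans (normr_clip _ _))// (bigD1 j)//= lerDl.
  exact: sumr_ge0.
have mv j : measurable_fun `[0, T] (fun s => v s j 0).
  rewrite (_ : (fun _ => _) = clip (M j) \o (fun s => u s j 0)); last first.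
    by apply/funext => s; rewrite mxE.
  apply: measurableT_comp; first exact: measurable_clip.
  exact: integrable_measurable_fun (iu j).
have iv j : mu.-integrable `[0, T] (EFin \o (fun s => v s j 0)).
  apply: le_integrable (iu j) => //; first by apply/measurable_EFinP; exact: mv.
  move=> s _ /=; rewrite lee_fin mxE.
  exact: normr_clip_le.
pose fr z := f (clipv r z); pose Gr z := G (clipv r z).
have cfGr : continuous_system fr Gr.
  split=> [z|i j z].
    by apply: (@continuous_comp _ _ _ (clipv r) f); [exact: continuous_clipv|exact: cf].
  by apply: (@continuous_comp _ _ _ (clipv r) (fun w => G w i j));
    [exact: continuous_clipv|exact: cG].
have lip w a b : `|velocity fr Gr a w - velocity fr Gr b w| <=
    L * (1 + absum w) * `|a - b|.
  have [fL GL] := LP (clipv r a) (clipv r b) (norm_clipv _ r0) (norm_clipv _ r0).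
  have cl : L * `|clipv r a - clipv r b| <= L * `|a - b|.
    by rewrite ler_wpM2l// clipv_lipschitz.
  by apply: velocity_lipschitz => // [|i j]; [exact: le_trans fL cl|exact: le_trans (GL i j) cl].
have kn0 w : 0 <= L * (1 + absum w) :> R by rewrite mulr_ge0// addr_ge0// absum_ge0.
have [y cy yE] := @caratheodory_existence _ n T _ (fun s z => velocity fr Gr z (v s)) z0
  T0 (integrable_lipschitz_kernel L iv) (fun s a b _ => le_trans (lip (v s) a b)
    (ler_wpM2r (normr_ge0 _) (ler_norm _)))
  (fun y cy i => integrable_velocity i cfGr T0 cy iv).
have xr s : 0 <= s <= T -> clipv r (x s) = x s.
  by move=> sT; rewrite clipv_id// (le_trans (xK s sT))// lerDl ltW.
have ixu i := integrable_velocity i cfGr T0 cx iu.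
have iyu i := integrable_velocity i cfGr T0 cy iu.
have iyv i := integrable_velocity i cfGr T0 cy iv.
pose eta := C * \sum_(j < k) d.
have close t : 0 <= t <= T -> `|y t - x t| <= e.
  have eta0 : 0 <= eta by rewrite mulr_ge0// sumr_ge0// => j _; exact: ltW.
  move=> tT; apply: (@le_trans _ _ (K * eta)).
    (* The difference of velocities is split at (y, u): from (x, u) to (y, u) only the state moves,
       which is controlled by the kernel of the given [u]; from (y, u) to (y, v) only the control
       moves, which is the perturbation [eta]. Keeping the kernel of [u] makes [K] independent of
       the truncation levels. *)
    apply: (KP n (fun s => y s - x s)
      (fun s => velocity fr Gr (y s) (u s) - velocity fr Gr (x s) (u s)) eta) => //.
    - exact: (within_continuousB cy cx).
    - move=> i; rewrite (_ : _ \o _ = EFin \o (fun s => velocity fr Gr (y s) (u s) i 0 -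
        velocity fr Gr (x s) (u s) i 0)); first exact: integrable_subr.
      by apply/funext => s; rewrite /= cV_subE.
    - move=> s sT; rewrite [X in X * _]ger0_norm//.
    - move=> q i qT; have /andP[_ q1] := qT.
      have -> : (y q - x q) i 0 - \int[mu]_(s in `[0, q])
          (velocity fr Gr (y s) (u s) - velocity fr Gr (x s) (u s)) i 0 =
          \int[mu]_(s in `[0, q]) (velocity fr Gr (y s) (v s) i 0 -
            velocity fr Gr (y s) (u s) i 0).
        have -> : \int[mu]_(s in `[0, q])
            (velocity fr Gr (y s) (u s) - velocity fr Gr (x s) (u s)) i 0 =
          \int[mu]_(s in `[0, q]) (velocity fr Gr (y s) (u s) i 0 -
            velocity fr Gr (x s) (u s) i 0).
          by apply: eq_Rintegral => s _; rewrite cV_subE.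
        rewrite !RintegralB//; try exact: integrable_prefix (ixu i);
          try exact: integrable_prefix (iyu i); try exact: integrable_prefix (iyv i).
        rewrite cV_subE yE// xE//.
        have -> : \int[mu]_(s in `[0, q]) velocity f G (x s) (u s) i 0 =
            \int[mu]_(s in `[0, q]) velocity fr Gr (x s) (u s) i 0.
          apply: eq_Rintegral => s; rewrite inE/= in_itv/= => /andP[s0 sq].
          by rewrite /velocity /fr /Gr xr// s0 (le_trans sq).
        ring.
      apply: (@le_trans _ _ (\int[mu]_(s in `[0, q]) (C * absum (v s - u s)))).
        apply: le_norm_Rintegral_dom => //.
        + by apply: integrable_subr => //; [exact: integrable_prefix (iyv i)|
            exact: integrable_prefix (iyu i)].
        + apply: integrable_mull => //; apply: integrable_absum => j.
          rewrite (_ : _ \o _ = EFin \o (fun s => v s j 0 - u s j 0)).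
            by apply: integrable_subr => //; [exact: integrable_prefix (iv j)|
              exact: integrable_prefix (iu j)].
          by apply/funext => s; rewrite /= cV_subE.
        + move=> s _; apply: velocity_control_dist => j.
          by apply: CP; exact: norm_clipv.
      have iuv j : mu.-integrable `[0, T] (EFin \o (fun s => `|u s j 0 - clip (M j) (u s j 0)|)).
        exact: integrable_sub_clip.
      have -> : (fun s => C * absum (v s - u s)) =
          (fun s => C * \sum_j `|u s j 0 - clip (M j) (u s j 0)|).
        apply/funext => s; congr (_ * _); apply: eq_bigr => j _.
        by rewrite cV_subE distrC [v s j 0]mxE.
      rewrite RintegralZl//; last first.
        by apply: integrable_sum_fin => // j; exact: integrable_prefix (iuv j).
      rewrite ler_wpM2l// Rintegral_sum_fin//; last by move=> j; exact: integrable_prefix (iuv j).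
      apply: ler_sum => j _; apply: le_trans ((MP j).2).
      rewrite fine_le ?integrable_fin_num//; first exact: integrable_prefix (iuv j).
        exact: iuv.
      apply: ge0_subset_integral => //.
      + exact: (measurable_int mu (iuv j)).
      + by apply: subset_itvl; rewrite bnd_simp.
  rewrite /eta sumr_const card_ord -mulr_natr /d.
  have : K * (C * (e / (K * (C * (k%:R + 1)) + 1) * k%:R)) =
    e * ((K * (C * k%:R)) / (K * (C * (k%:R + 1)) + 1)) by ring.
  move=> ->; rewrite ler_piMr ?(ltW e0)// ler_pdivrMr// mul1r.
  by have := mulr_ge0 K0 C0; lra.
have yr s : 0 <= s <= T -> clipv r (y s) = y s.
  move=> sT; rewrite clipv_id// -[y s](subrK (x s)) (le_trans (ler_normD _ _))//.
  by rewrite addrC lerD ?xK ?close.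
exists (\sum_j M j), v, y; split => //; split => // t i tT; rewrite yE//; congr (_ + _).
apply: eq_Rintegral => s; rewrite inE/= in_itv/= => /andP[s0 st].
by rewrite /velocity /fr /Gr yr// s0 (le_trans st)//; case/andP: tT.
Qed.

End Truncation.

(** * Half-line integrals and polynomial decay *)

Section IntervalTools.
Context {R : realType}.

(** The right end [b] is generic so that one splitting serves both bounded intervals and the
    half-line. *)
Lemma itv_cc_split (T : R) (b : itv_bound R) : (BRight T <= b)%O -> 0 <= T ->
  [set` Interval (BLeft 0) b] = `[0, T] `|` [set` Interval (BRight T) b].
Proof. by move=> Tb T0; rewrite -itv_bndbnd_setU// bnd_simp. Qed.

Lemma disjoint_itv_split (T : R) (b : itv_bound R) :
  [disjoint `[0, T] & [set` Interval (BRight T) b]].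
Proof.
apply/disj_setPS => s [/=]; rewrite !in_itv/= => /andP[_ sT] /andP[Ts _].
by have := lt_le_trans Ts sT; rewrite ltxx.
Qed.

Lemma measurable_fun_itv_cat (T : R) (b : itv_bound R) (h : R -> R) :
  (BRight T <= b)%O -> 0 <= T -> measurable_fun `[0, T] h ->
  measurable_fun [set` Interval (BRight T) b] h ->
  measurable_fun [set` Interval (BLeft 0) b] h.
Proof.
by move=> Tb T0 h1 h2; rewrite (itv_cc_split Tb T0); apply/measurable_funU.
Qed.

Lemma integrable_itv_cat (T : R) (b : itv_bound R) (h : R -> R) :
  (BRight T <= b)%O -> 0 <= T ->
  mu.-integrable `[0, T] (EFin \o h) ->
  mu.-integrable [set` Interval (BRight T) b] (EFin \o h) ->
  mu.-integrable [set` Interval (BLeft 0) b] (EFin \o h).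
Proof.
move=> Tb T0 i1 i2.
have mh : measurable_fun [set` Interval (BLeft 0) b] h.
  by apply: (measurable_fun_itv_cat Tb T0); exact: integrable_measurable_fun.
apply/integrableP; split; first by apply/measurable_EFinP; exact: mh.
have mh' : measurable_fun [set` Interval (BLeft 0) b] (fun s => `|(EFin \o h) s|%E).
  by apply: measurableT_comp => //; apply/measurable_EFinP; exact: mh.
rewrite (itv_cc_split Tb T0) in mh' *.
rewrite ge0_integral_setU//; last exact: disjoint_itv_split.
by apply: lte_add_pinfty; [case/integrableP: i1|case/integrableP: i2].
Qed.

(** Continuity is local: near [t] only the points of [0, t + 1] matter. *)
Lemma within_continuous_half_line (V : normedModType R) (y : R -> V) :
  (forall T : R, 0 <= T -> {within `[0, T], continuous y}) ->
  {within `[0, +oo[, continuous y}.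
Proof.
move=> cy; apply/subspace_continuousP => t; rewrite /= in_itv/= andbT => t0.
have tT : `[0, t + 1]%classic t by rewrite /= in_itv/= t0 lerDl ler01.
have /subspace_continuousP/(_ t tT) := cy (t + 1) (addr_ge0 t0 ler01).
move=> /cvgrPdist_le H; apply/cvgrPdist_le => e e0.
have := H e e0; rewrite !near_withinE => H1.
have H2 : \forall s \near t, s < t + 1 by apply: lt_nbhsl; rewrite ltrDl.
near=> s => s0.
have sT : `[0, t + 1]%classic s.
  move: s0; rewrite /= !in_itv/= => /andP[-> _]/=.
  by apply: ltW; near: s.
by move: sT; near: s.
Unshelve. all: by end_near. Qed.

Lemma is_derive_shift1 (T t : R) : is_derive t 1 (fun s => s - T) 1.
Proof. by apply: is_derive_eq; rewrite subr0. Qed.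

Lemma integral_shift (T t : R) (h : R -> R) : 0 <= t ->
  {within `[0, t], continuous h} ->
  \int[mu]_(s in `[T, T + t]) h (s - T) = \int[mu]_(s in `[0, t]) h s.
Proof.
move=> t0 ch; pose F s := s - T.
have dF : derive1 F = cst 1.
  apply/funext => s; rewrite derive1E.
  by have /@derive_val := is_derive_shift1 T s.
have cF : continuous F.
  by move=> s; apply: cvgB; [exact: cvg_id|exact: cvg_cst].
have FT : F T = 0 by rewrite /F subrr.
have FTt : F (T + t) = t by rewrite /F addrAC subrr add0r.
rewrite /Rintegral -[X in `[X, t]]FT -[X in `[_, X]]FTt.
rewrite (@integration_by_substitution_increasing _ F h T (T + t)).
- by congr fine; apply: eq_integral => s _ /=; rewrite dF /= mulr1.
- by rewrite lerDl.
- by move=> p q _ _ pq; rewrite /F ltrD2r.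
- by move=> s _; rewrite dF; exact: cst_continuous.
- by rewrite dF; exact: is_cvg_cst.
- by rewrite dF; exact: is_cvg_cst.
- split.
  + by move=> s _; have /@ex_derive := is_derive_shift1 T s.
  + exact/cvg_at_right_filter/cF.
  + exact/cvg_at_left_filter/cF.
- by rewrite FT FTt.
Qed.

Lemma within_continuous_shift (V : normedModType R) (T t : R) (h : R -> V) :
  {within `[0, t], continuous h} ->
  {within `[T, T + t], continuous (fun s => h (s - T))}.
Proof.
move=> /subspace_continuousP ch; apply/subspace_continuousP => s.
rewrite /= in_itv/= => /andP[Ts st].
have sT : `[0, t]%classic (s - T) by rewrite /= in_itv/= subr_ge0 Ts lerBlDl.
have /cvgrPdist_le H := ch _ sT; apply/cvgrPdist_le => e e0.
have := H e e0; rewrite !near_withinE => H1.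
have cT : (fun r => r - T) @ s --> s - T by apply: cvgB; [exact: cvg_id|exact: cvg_cst].
have H2 := cT _ H1; near=> r; rewrite /= in_itv/= => /andP[Tr rt].
have H3 : `[0, t]%classic (r - T) -> `|h (s - T) - h (r - T)| <= e by near: r.
by apply: H3; rewrite /= in_itv/= subr_ge0 Tr lerBlDl.
Unshelve. all: by end_near. Qed.

Lemma within_continuous_shift_half_line (V : normedModType R) (T : R) (h : R -> V) :
  {within `[0, +oo[, continuous h} ->
  {within `[T, +oo[, continuous (fun s => h (s - T))}.
Proof.
move=> /subspace_continuousP ch; apply/subspace_continuousP => s.
rewrite /= in_itv/= andbT => Ts.
have sT : `[0, +oo[%classic (s - T) by rewrite /= in_itv/= subr_ge0 Ts.
have /cvgrPdist_le H := ch _ sT; apply/cvgrPdist_le => e e0.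
have := H e e0; rewrite !near_withinE => H1.
have cT : (fun r => r - T) @ s --> s - T by apply: cvgB; [exact: cvg_id|exact: cvg_cst].
have H2 := cT _ H1; near=> r; rewrite /= in_itv/= andbT => Tr.
have H3 : `[0, +oo[%classic (r - T) -> `|h (s - T) - h (r - T)| <= e by near: r.
by apply: H3; rewrite /= in_itv/= subr_ge0 Tr.
Unshelve. all: by end_near. Qed.

Lemma powR_gt0_cvg0 (r : R) : 0 < r -> x `^ (- r) @[x --> +oo] --> 0.
Proof.
move=> r0; apply/cvgrPdist_le => e e0; near=> x.
rewrite sub0r normrN ger0_norm ?powR_ge0// powRN.
have x0 : 0 < x by near: x; apply: nbhs_pinfty_gt; exact: num_real.
rewrite invf_ple ?posrE ?powR_gt0//.
have -> : e^-1 = (e^-1 `^ r^-1) `^ r.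
  by rewrite -powRrM mulVf ?gt_eqF// powRr1// invr_ge0 ltW.
by rewrite ge0_ler_powR ?nnegrE ?powR_ge0 ?(ltW r0) ?(ltW x0)//.
Unshelve. all: by end_near. Qed.

(** Used with q = r alpha for L_r membership of the control and with q = 2 alpha for the cost of the
    tail. *)
Lemma integral_powR_tail (T q : R) : 1 < q ->
  (\int[mu]_(s in `[T, +oo[) ((s - T + 1) `^ (- q))%:E = ((q - 1)^-1)%:E)%E.
Proof.
move=> q1; have q0 : 0 < q - 1 by rewrite subr_gt0.
pose S s := s - T + 1.
have dS (s : R) : is_derive s 1 S 1 by apply: is_derive_eq; rewrite subr0 addr0.
have cS : continuous S.
  by move=> s; apply: cvgD; [apply: cvgB; [exact: cvg_id|exact: cvg_cst]|exact: cvg_cst].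
pose F (s : R) := - (q - 1)^-1 * (S s) `^ (- (q - 1)).
have S0 s : T <= s -> 0 < S s by rewrite /S; lra.
have dF (s : R) : T <= s -> is_derive s 1 F ((S s) `^ (- q)).
  move=> Ts; have Ss := S0 s Ts.
  have dp : is_derive (S s) 1 (fun x => x `^ (- (q - 1))) (- (q - 1) * (S s) `^ (- q)).
    split; first by apply: derivable_powR; rewrite in_itv/= Ss.
    rewrite -derive1E powR_derive1 ?in_itv/= ?Ss//; congr (_ * _ `^ _); ring.
  have dc : is_derive s 1 ((fun x => x `^ (- (q - 1))) \o S) (- (q - 1) * (S s) `^ (- q) * 1).
    exact: is_derive1_comp.
  have := @is_deriveZ _ _ _ _ (- (q - 1)^-1) _ _ _ dc.
  rewrite /GRing.scale/= mulr1 mulrA mulNr mulrN opprK mulVf ?gt_eqF// mul1r.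
  by [].
have cF s : T <= s -> {for s, continuous F}.
  by move=> Ts; apply/differentiable_continuous/derivable1_diffP; have /@ex_derive := dF s Ts.
have cp : {within `[T, +oo[, continuous (fun s => (S s) `^ (- q))}.
  apply/subspace_continuousP => s; rewrite /= in_itv/= andbT => Ts.
  apply: cvg_within_filter.
  apply: (@continuous_comp _ _ _ S (fun x => x `^ (- q))); first exact: cS.
  apply/differentiable_continuous/derivable1_diffP.
  by apply: derivable_powR; rewrite in_itv/= S0.
have F0 : F x @[x --> +oo] --> 0.
  rewrite -[X in _ --> X](mulr0 (- (q - 1)^-1)); apply: cvgMr.
  have := powR_gt0_cvg0 q0.
  have : S x @[x --> +oo] --> +oo.
    apply/cvgryPge => A; near=> x; rewrite /S.
    suff : A + T - 1 <= x by lra.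
    by near: x; apply: nbhs_pinfty_ge; exact: num_real.
  exact: cvg_comp.
rewrite (ge0_continuous_FTC2y _ cp F0).
- have -> : F T = - (q - 1)^-1.
    rewrite /F (_ : S T = 1); last by rewrite /S subrr add0r.
    by rewrite powR1 mulr1.
  by rewrite -EFinB opprK add0r.
- by move=> x _; exact: powR_ge0.
- by move=> x Tx; have /@ex_derive := dF x (ltW Tx).
- by apply: cvg_at_right_filter; exact: cF.
- move=> x; rewrite in_itv/= andbT => Tx; rewrite derive1E.
  by have /@derive_val := dF x (ltW Tx).
Unshelve. all: by end_near. Qed.

End IntervalTools.

(** * Switching to the feedback *)

Section Concatenation.
Context {R : realType} {n k : nat}.
Variables (f : 'cV[R]_n -> 'cV[R]_n) (G : 'cV[R]_n -> 'M[R]_(n, k)).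

Definition concat (V : Type) (T : R) (a b : R -> V) (t : R) : V :=
  if t <= T then a t else b (t - T).

Lemma trajectory_solution_on (T : R) z0 u x : trajectory f G z0 u x ->
  solution_on f G T z0 u x.
Proof.
move=> [cx xE]; split.
  apply: continuous_subspaceW cx => t; rewrite /= !in_itv/= andbT.
  by case/andP.
by move=> t i /andP[t0 _]; have [_ ->] := xE t i t0.
Qed.

Lemma continuous_velocity_feedback (ub : 'cV[R]_n -> 'cV[R]_k) i :
  continuous_system f G -> continuous ub ->
  continuous (fun a => velocity f G a (ub a) i 0).
Proof.
move=> [cf cG] cub.
rewrite (_ : (fun _ => _) = fun a => f a i 0 + \sum_j G a i j * ub a j 0); last first.
  by apply/funext => a; rewrite !mxE.
have cj j : continuous (fun a : 'cV[R]_n => ub a j 0).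
  move=> a; apply: (@continuous_comp _ _ _ ub (fun w : 'cV[R]_k => w j 0)); first exact: cub.
  exact: coord_continuous.
have cs : continuous (fun a : 'cV[R]_n => \sum_j G a i j * ub a j 0).
  by apply: continuous_sum => j; apply: continuous_mulr; [exact: cG|exact: cj].
have cfi : continuous (fun a : 'cV[R]_n => f a i 0).
  move=> a; apply: (@continuous_comp _ _ _ f (fun w : 'cV[R]_n => w i 0)); first exact: cf.
  exact: coord_continuous.
by move=> a; apply: (@cvgD _ _ _ _ (nbhs_filter a)); [exact: cfi|exact: cs].
Qed.

(** The closed-loop system is autonomous, so its trajectory from [y T], delayed by [T], continues
    [y]. *)
Lemma concat_trajectory (T : R) z0 (v : R -> 'cV[R]_k) (y z : R -> 'cV[R]_n)
    (ub : 'cV[R]_n -> 'cV[R]_k) :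
  continuous_system f G -> continuous ub -> 0 <= T ->
  (forall j, mu.-integrable `[0, T] (EFin \o (fun s => v s j 0))) ->
  solution_on f G T z0 v y -> trajectory f G (y T) (ub \o z) z ->
  trajectory f G z0 (concat T v (ub \o z)) (concat T y z).
Proof.
move=> cfG cub T0 iv [cy yE] [cz zE].
set X := concat T y z; set w := concat T v (ub \o z).
pose h i s := velocity f G (z s) (ub (z s)) i 0.
have chi i (t : R) : {within `[0, t], continuous (h i)}.
  apply: (@within_continuous_comp_cV _ _ _ _ z (fun a => velocity f G a (ub a) i 0)).
    exact: continuous_velocity_feedback.
  apply: continuous_subspaceW cz => s; rewrite /= !in_itv/= andbT.
  by case/andP.
have V1 i s : s <= T -> velocity f G (X s) (w s) i 0 = velocity f G (y s) (v s) i 0.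
  by move=> sT; rewrite /X /w /concat sT.
(* At [s = T] the concatenation still follows [y], so this formula holds on []T, t]] only; the
   missing endpoint is a null set. *)
have V2 i s : T < s -> velocity f G (X s) (w s) i 0 = h i (s - T).
  by move=> sT; rewrite /X /w /concat leNgt sT.
have iyv i := integrable_velocity i cfG T0 cy iv.
have ih i t : T <= t -> mu.-integrable `[T, t] (EFin \o (fun s => h i (s - T))).
  move=> Tt; apply: continuous_compact_integrable; first exact: segment_compact.
  have -> : t = T + (t - T) by rewrite addrC subrK.
  exact: (@within_continuous_shift R R T (t - T) (h i)).
have iV1 i t : t <= T -> mu.-integrable `[0, t]
    (EFin \o (fun s => velocity f G (X s) (w s) i 0)).
  move=> tT; apply: eq_integrable (integrable_prefix tT (iyv i)) => // s.
  by rewrite inE/= in_itv/= => /andP[_ st]; rewrite V1// (le_trans st).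
have iV2 i t : T <= t -> mu.-integrable `]T, t]
    (EFin \o (fun s => velocity f G (X s) (w s) i 0)).
  move=> Tt; have : mu.-integrable `]T, t] (EFin \o (fun s => h i (s - T))).
    by apply: integrableS (ih i t Tt) => //; exact: subset_itv_oc_cc.
  apply: eq_integrable => // s.
  by rewrite inE/= in_itv/= => /andP[Ts _]; rewrite V2.
have iV i t : 0 <= t -> mu.-integrable `[0, t]
    (EFin \o (fun s => velocity f G (X s) (w s) i 0)).
  move=> t0; have [tT|/ltW Tt] := leP t T; first exact: iV1.
  by apply: (integrable_itv_cat _ T0 (iV1 i T (lexx T)) (iV2 i t Tt)); rewrite bnd_simp.
have XE i t : 0 <= t ->
    X t i 0 = z0 i 0 + \int[mu]_(s in `[0, t]) velocity f G (X s) (w s) i 0.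
  move=> t0; have XT q : 0 <= q <= T ->
      \int[mu]_(s in `[0, q]) velocity f G (X s) (w s) i 0 =
      \int[mu]_(s in `[0, q]) velocity f G (y s) (v s) i 0.
    move=> /andP[_ qT]; apply: eq_Rintegral => s; rewrite inE/= in_itv/= => /andP[_ st].
    by rewrite V1// (le_trans st).
  have [tT|Tt] := leP t T.
    by rewrite {1}/X /concat tT XT ?t0// yE// t0.
  rewrite {1}/X /concat leNgt Tt/=.
  have tT0 : 0 <= t - T by rewrite subr_ge0 ltW.
  have [_ ->] := zE (t - T) i tT0; rewrite yE ?T0 ?lexx// -XT ?T0 ?lexx//.
  rewrite -addrA; congr (_ + _).
  have <- : \int[mu]_(s in `]T, t]) velocity f G (X s) (w s) i 0 =
      \int[mu]_(s in `[0, t - T]) h i s.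
    rewrite -(integral_shift T tT0 (chi i _)) (addrC T) subrK.
    rewrite -Rintegral_itv_obnd_cbnd; last first.
      by apply: integrableS (ih i t (ltW Tt)) => //; exact: subset_itv_oc_cc.
    by apply: eq_Rintegral => s; rewrite inE/= in_itv/= => /andP[Ts _]; rewrite V2.
  rewrite -(@Rintegral_itvB _ (fun s => velocity f G (X s) (w s) i 0) (BLeft 0) (BRight t) T
    (iV i t t0)) ?bnd_simp//; last exact: ltW.
  by rewrite addrC subrK.
split=> [|t i t0]; last by split; [exact: iV|exact: XE].
(* No gluing at [T]: the integral equation already holds, and its right-hand side is continuous in
   the upper limit. *)
apply: within_continuous_half_line => S S0.
apply: within_continuous_cV => i.
have : {within `[0, S], continuous (cst (z0 i 0) +
    (fun t => \int[mu]_(s in `[0, t]) velocity f G (X s) (w s) i 0))}.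
  apply: within_continuousD; last by apply: parameterized_integral_continuous => //; exact: iV.
  by apply: continuous_subspaceT; exact: cst_continuous.
apply: subspace_eq_continuous => t; rewrite inE/= in_itv/= => /andP[t0 _].
by rewrite [RHS]XE.
Qed.

End Concatenation.

(** * Membership in L_p and the cost of a decaying tail *)

Section Costs.
Context {R : realType}.
Local Open Scope ereal_scope.

Lemma Lfun_bounded (g : R -> R) (M : R) : measurable_fun setT g ->
  (forall t, (`|g t| <= M)%R) -> g \in Lfun mu +oo.
Proof.
move=> mg gM; rewrite inE; apply/andP; split; rewrite inE//=.
rewrite /finite_norm unlock /Lnorm; case: ifPn => // _.
apply: (@le_lt_trans _ _ M%:E); last exact: ltry.
by apply/ess_sup_inf.ess_supP; apply: nearW => t /=; rewrite lee_fin.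
Qed.

Lemma Lfun_powR (g : R -> R) (r : R) : (1 <= r)%R -> measurable_fun setT g ->
  \int[mu]_t (`|g t| `^ r)%:E < +oo -> g \in Lfun mu r%:E.
Proof.
move=> r1 mg goo; rewrite inE; apply/andP; split; rewrite inE//=.
rewrite /finite_norm unlock /Lnorm; apply: poweR_lty.
by under eq_integral do rewrite /=.
Qed.

(** On [0, T] the r-th power is at most M^r on a set of finite measure; beyond, it is at most D^r (t
    - T + 1)^(- r alpha), integrable since r alpha > 1. *)
Lemma Lfun_decay (g : R -> R) (T M D alpha r : R) : (0 <= T)%R -> (0 <= D)%R ->
  (1 <= r)%R -> (1 < r * alpha)%R -> measurable_fun (`[0%R, +oo[ : set R) g ->
  (forall t, (0 <= t <= T)%R -> (`|g t| <= M)%R) ->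
  (forall t, (T < t)%R -> (`|g t| <= D * (t - T + 1) `^ (- alpha))%R) ->
  g \_ (`[0%R, +oo[ : set R) \in Lfun mu r%:E.
Proof.
move=> T0 D0 r1 ra mg gM gD.
have r0 : (0 < r)%R by lra.
have mpow : measurable_fun setT (fun t : R => `|t| `^ r)%R.
  by apply: (measurableT_comp (measurable_powR r)).
have mgr : measurable_fun (`[0%R, +oo[ : set R) (fun t => (`|g t| `^ r)%:E).
  by apply/measurable_EFinP; exact: (measurableT_comp mpow mg).
apply: Lfun_powR => //; first exact/(measurable_restrictT _ _).1.
have -> : \int[mu]_t (`|(g \_ `[0%R, +oo[) t| `^ r)%:E =
    \int[mu]_(t in `[0%R, +oo[) (`|g t| `^ r)%:E.
  rewrite [RHS]integral_mkcond; apply: eq_integral => t _.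
  by rewrite !patchE; case: ifPn => // _; rewrite normr0 powR0// gt_eqF.
rewrite (itv_cc_split (T := T)) ?bnd_simp// in mgr *.
rewrite ge0_integral_setU//; last exact: disjoint_itv_split.
have [m1 m2] := (measurable_funU _ (measurable_itv _) (measurable_itv _)).1 mgr.
apply: lte_add_pinfty.
  apply: (@le_lt_trans _ _ (\int[mu]_(t in `[0%R, T]) (M `^ r)%:E)).
    apply: ge0_le_integral => //.
    move=> t; rewrite /= in_itv/= => tT; rewrite lee_fin ge0_ler_powR ?nnegrE ?(ltW r0)//.
      by rewrite (le_trans (normr_ge0 (g t)))// gM.
    exact: gM.
  by rewrite integral_cst//= lebesgue_measure_itv/= lte_fin; case: ifPn => _;
    rewrite ?mule0 ?ltry// -EFinD -EFinM ltry.
pose s2 t := ((D `^ r)%:E * ((t - T + 1) `^ (- (r * alpha)))%:E).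
have mD : measurable_fun (`[T, +oo[ : set R) (fun t : R => ((t - T + 1) `^ (- (r * alpha)))%:E).
  apply/measurable_EFinP; apply: (measurableT_comp (measurable_powR _)).
  by apply: measurable_funD => //; apply: measurable_funB.
apply: (@le_lt_trans _ _ (\int[mu]_(t in `[T, +oo[) s2 t)).
  rewrite -integral_itv_obnd_cbnd; last first.
    by apply: measurable_funeM; apply: measurable_funS mD => //;
        apply: subset_itvr; rewrite bnd_simp.
  apply: ge0_le_integral => //.
    by apply: measurable_funeM; apply: measurable_funS mD => //;
        apply: subset_itvr; rewrite bnd_simp.
  move=> t; rewrite /= in_itv/= andbT => Tt; rewrite /s2 -EFinM lee_fin.
  have -> : (D `^ r * (t - T + 1) `^ (- (r * alpha)) =
      (D * (t - T + 1) `^ (- alpha)) `^ r)%R.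
    by rewrite powRM ?powR_ge0// -powRrM mulNr (mulrC alpha).
  rewrite ge0_ler_powR ?nnegrE ?(ltW r0)//.
    by rewrite mulr_ge0 ?powR_ge0.
  exact: gD.
rewrite /s2 ge0_integralZl_EFin//.
- by rewrite integral_powR_tail// -EFinM ltry.
- by move=> t _; rewrite lee_fin powR_ge0.
- exact: powR_ge0.
Qed.

(** Squaring the decay rate gives the exponent 2 alpha, integrable because alpha > 1/2; the factor 1
    / (2 alpha - 1) is the value of that integral. *)
Lemma tail_integral_le (q : R -> R) (T B alpha : R) : (2^-1 < alpha)%R ->
  measurable_fun `]T, +oo[ q -> (0 <= B)%R ->
  (forall t, (T < t)%R -> (0 <= q t <= B * ((t - T + 1) `^ (- alpha)) ^+ 2)%R) ->
  \int[mu]_(t in `]T, +oo[) (q t)%:E <= (B / (2 * alpha - 1))%:E.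
Proof.
move=> a2 mq B0 qB.
have a1 : (1 < 2 * alpha)%R by lra.
have mD : measurable_fun (`[T, +oo[ : set R) (fun t : R => ((t - T + 1) `^ (- (2 * alpha)))%:E).
  apply/measurable_EFinP; apply: (measurableT_comp (measurable_powR _)).
  by apply: measurable_funD => //; apply: measurable_funB.
have -> : (B / (2 * alpha - 1))%:E =
    \int[mu]_(t in `[T, +oo[) (B%:E * ((t - T + 1) `^ (- (2 * alpha)))%:E).
  rewrite ge0_integralZl_EFin//; last by move=> t _; rewrite lee_fin powR_ge0.
  by rewrite integral_powR_tail.
rewrite -integral_itv_obnd_cbnd; last first.
  by apply: measurable_funeM; apply: measurable_funS mD => //;
      apply: subset_itvr; rewrite bnd_simp.
apply: ge0_le_integral => //.
- by move=> t; rewrite /= in_itv/= andbT => Tt; rewrite lee_fin; case/andP: (qB t Tt).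
- exact/measurable_EFinP.
- by apply: measurable_funeM; apply: measurable_funS mD => //;
    apply: subset_itvr; rewrite bnd_simp.
- move=> t; rewrite /= in_itv/= andbT => Tt; rewrite -EFinM lee_fin.
  case/andP: (qB t Tt) => _ /le_trans; apply.
  by rewrite -powR_mulrn ?powR_ge0// -powRrM mulNr (mulrC alpha).
Qed.

(** The norm of exponent [+oo] unfolds to an essential supremum only under this positivity test. *)
Lemma lebesgue_measure_setT_gt0 : 0 < mu (setT : set R).
Proof. by rewrite -set_itvNyy lebesgue_measure_itv/= ltry. Qed.

(** It gives the easy inequality between the two infima, and it makes the constructed control
    locally integrable, hence its trajectory unique. *)
Lemma Linfty_sub_L1loc k : Lp k +oo `<=` L1loc R k.
Proof.
move=> u uoo i T T0.
have := uoo i; set g := _ \_ _; rewrite inE => /andP[]; rewrite !inE /= => mg.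
rewrite /finite_norm unlock /Lnorm.
rewrite ifT; last first.
  exact: lebesgue_measure_setT_gt0.
move=> goo; have [M gM] := ess_sup_inf.ess_supr_bounded goo.
have mgT : measurable_fun `[0%R, T] g by exact: measurable_funS mg.
have ig : mu.-integrable `[0%R, T] (EFin \o g).
  apply/integrableP; split; first by apply/measurable_EFinP; exact: mgT.
  apply: (@le_lt_trans _ _ (\int[mu]_(t in `[0%R, T]) `|M|%:E)).
    apply: ae_ge0_le_integral => //.
      by apply: measurableT_comp => //; apply/measurable_EFinP; exact: mgT.
    apply: filterS gM => t gtM _ /=; rewrite lee_fin.
    exact: le_trans gtM (ler_norm M).
  by rewrite integral_cst//= lebesgue_measure_itv/= lte_fin; case: ifPn => _;
    rewrite ?mule0 ?ltry// -EFinD -EFinM ltry.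
apply: eq_integrable ig => // t; rewrite inE/= in_itv/= => /andP[t0 _].
by rewrite /g /= patchE ifT// inE/= in_itv/= t0.
Qed.

End Costs.

(** * Absence of the Lavrentiev gap *)

Section LavrentievGap.
Context {R : realType} {n k : nat}.

Lemma smooth_system (f : 'cV[R]_n -> 'cV[R]_n) (g : 'I_k -> 'cV[R]_n -> 'cV[R]_n) :
  smooth f -> (forall j, smooth (g j)) ->
  lipschitz_on_balls f (fields_mx g) /\ continuous_system f (fields_mx g).
Proof.
move=> sf sg; split=> [r|].
  have [L L0 fL] := C1_lipschitz_ball r (sf 1%N).
  have /choice[Lg LgP] (j : 'I_k) : exists K : R, 0 <= K /\ forall a b,
      `|a| <= r -> `|b| <= r -> `|g j b - g j a| <= K * `|b - a|.
    by have [K ? ?] := C1_lipschitz_ball r (sg j 1%N); exists K.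
  have S0 : 0 <= \sum_j Lg j by apply: sumr_ge0 => j _; have [] := LgP j.
  exists (L + \sum_j Lg j); first exact: addr_ge0.
  move=> a b ar br; split=> [|i j].
    by rewrite (le_trans (fL _ _ br ar))// ler_wpM2r// lerDl.
  rewrite !mxE -cV_subE (le_trans (coord_le_norm _ _ _))//.
  rewrite (le_trans ((LgP j).2 _ _ br ar))// ler_wpM2r//.
  rewrite (bigD1 j)//= addrCA lerDl addr_ge0// sumr_ge0// => i' _.
  by have [] := LgP i'.
split=> [|i j]; first exact: class_C1_continuous (sf 1%N).
have -> : (fun z => fields_mx g z i j) = (fun z => g j z i 0).
  by apply/funext => z; rewrite mxE.
move=> z; apply: (@continuous_comp _ _ _ (g j) (fun w : 'cV[R]_n => w i 0)).
  exact: class_C1_continuous (sg j 1%N) z.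
exact: coord_continuous.
Qed.

Lemma lipschitz_le_continuous (U V : normedModType R) (h : U -> V) (L : R) : 0 <= L ->
  (forall a b, `|h a - h b| <= L * `|a - b|) -> continuous h.
Proof.
move=> L0 hL a; apply/cvgrPdist_le => e e0; near=> b.
rewrite (le_trans (hL a b))//.
have : `|a - b| <= e / (L + 1).
  near: b; apply/nbhs_normP; exists (e / (L + 1)) => [|b /ltW//].
  by rewrite /= divr_gt0// ltr_wpDl.
move=> /(ler_wpM2l L0) /le_trans; apply.
rewrite mulrCA ler_piMr ?(ltW e0)// ler_pdivrMr ?ltr_wpDl// mul1r.
by rewrite lerDl.
Unshelve. all: by end_near. Qed.

(** The decay hypothesis is stated in the Euclidean norm and the estimates in the sup norm; this
    bound and the next one translate at the price of a factor [n]. *)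
Lemma norm_le_enorm (x : 'cV[R]_n) : `|x| <= enorm x.
Proof.
apply: norm_cV_le => [|i]; first exact: sqrtr_ge0.
rewrite -sqrtr_sqr ler_wsqrtr// (bigD1 i)//= lerDl sumr_ge0// => j _.
exact: sqr_ge0.
Qed.

Lemma enorm_le_norm (x : 'cV[R]_n) : enorm x <= n%:R * `|x|.
Proof.
rewrite -[leRHS]ger0_norm ?mulr_ge0// -sqrtr_sqr ler_wsqrtr//.
apply: (@le_trans _ _ (\sum_(i < n) `|x| ^+ 2)).
  apply: ler_sum => i _; rewrite -[x i 0 ^+ 2]ger0_norm ?sqr_ge0// normrX.
  by rewrite lerXn2r ?nnegrE// coord_le_norm.
rewrite sumr_const card_ord -[leLHS]mulr_natl exprMn ler_wpM2r ?sqr_ge0//.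
by rewrite -natrX ler_nat; case: n => // m; rewrite -mulnn leq_pmulr.
Qed.

Variables (P : 'M[R]_n) (f : 'cV[R]_n -> 'cV[R]_n) (G : 'cV[R]_n -> 'M[R]_(n, k)).
Hypotheses (lfG : lipschitz_on_balls f G) (cfG : continuous_system f G).
Hypothesis hP : sym_posdef P.

Lemma quadform_ge0 x : 0 <= quadform P x.
Proof.
have [c c0 qc] := quadform_ge hP; apply: le_trans (qc x).
by rewrite mulr_ge0 ?sqr_ge0// ltW.
Qed.

(** Uniqueness on every [0, t] makes the trajectory chosen by [cid] agree with [x]. *)
Lemma J0infty_trajectory z0 u x : L1loc R k u -> trajectory f G z0 u x ->
  J0infty P f G z0 u =
  (\int[lebesgue_measure]_(t in `[0%R, +oo[) (quadform P (x t))%:E)%E.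
Proof.
move=> iu tx; rewrite /J0infty; case: pselect => [ex|[]]; last by exists x.
apply: eq_integral => t; rewrite inE/= in_itv/= andbT => t0.
congr (quadform P _)%:E; have ty := svalP (cid ex).
apply: (@solution_on_unique _ _ _ f G t z0 u) => //.
- by move=> j; exact: iu.
- exact: trajectory_solution_on.
- exact: trajectory_solution_on.
- by rewrite t0 lexx.
Qed.

Lemma measurable_quadform_comp (D : set R) (x : R -> 'cV[R]_n) : measurable D ->
  {within D, continuous x} -> measurable_fun D (fun t => quadform P (x t)).
Proof.
move=> mD cx; apply: subspace_continuous_measurable_fun => //.
apply: (@within_continuous_comp_cV _ _ _ _ x (quadform P)) => //.
exact: continuous_quadform.
Qed.

(** If |x| stayed above d, the density would be at least c d^2 on a half-line of infinite
    measure. *)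
Lemma finite_cost_small_state (x : R -> 'cV[R]_n) (d : R) : 0 < d ->
  {within `[0, +oo[, continuous x} ->
  (\int[mu]_(t in `[0%R, +oo[) (quadform P (x t))%:E < +oo)%E ->
  exists2 T : R, 0 <= T & `|x T| <= d.
Proof.
move=> d0 cx; apply: contraPP => /forall2NP xd.
have [c c0 qc] := quadform_ge hP.
apply/negP; rewrite -leNgt.
have c'0 : 0 < c * d ^+ 2 by rewrite mulr_gt0// exprn_gt0.
apply: (@le_trans _ _ (\int[mu]_(t in (`[0%R, +oo[ : set R)) (c * d ^+ 2)%:E)%E).
  by rewrite integral_cst//= lebesgue_measure_itv/= ltry/= gt0_muley// lte_fin.
apply: ge0_le_integral => //.
- by move=> t _; rewrite lee_fin ltW.
- by apply/measurable_EFinP; exact: measurable_quadform_comp.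
- move=> t; rewrite /= in_itv/= andbT => t0; rewrite lee_fin (le_trans _ (qc _))//.
  rewrite ler_wpM2l ?(ltW c0)// lerXn2r ?nnegrE ?(ltW d0)//.
  by have [/(_ t0)//|/negP] := xd t; rewrite -ltNge => /ltW.
Qed.

Lemma integrable_bounded_control (T M : R) (v : R -> 'cV[R]_k) j :
  (forall t, `|v t| <= M) -> measurable_fun `[0, T] (fun s => v s j 0) ->
  mu.-integrable `[0, T] (EFin \o (fun s => v s j 0)).
Proof.
move=> vM mv; apply: le_integrable (integrable_const_itv 0 T M) => //.
  by apply/measurable_EFinP; exact: mv.
move=> t _ /=; rewrite lee_fin (le_trans (coord_le_norm _ _ _))//.
exact: le_trans (vM t) (ler_norm M).
Qed.

(** The disjunction on [p] covers both regimes of exponents. For [p = +oo] the bound [M + D] works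
    because (t - T + 1)^(- alpha) <= 1 after the switch. *)
Lemma concat_in_Lp (T M D alpha : R) (v : R -> 'cV[R]_k) (b : R -> 'cV[R]_k)
    (p : \bar R) : 0 <= T -> 0 <= D -> 0 <= alpha -> (forall t, `|v t| <= M) ->
  (forall j, measurable_fun `[0, T] (fun s => v s j 0)) ->
  {within `[0, +oo[, continuous b} ->
  (forall t, 0 <= t -> `|b t| <= D * (t + 1) `^ (- alpha)) ->
  p = +oo%E \/ (exists r : R, [/\ p = r%:E, 1 <= r & 1 < r * alpha]) ->
  Lp k p (concat T v b).
Proof.
move=> T0 D0 a0 vM mv cb bD hp j; set g := fun t => concat T v b t j 0.
have gD t : T < t -> `|g t| <= D * (t - T + 1) `^ (- alpha).
  move=> Tt; rewrite /g /concat (leNgt t) Tt/= (le_trans (coord_le_norm _ _ _))//.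
  by apply: bD; rewrite subr_ge0 ltW.
have gM t : 0 <= t <= T -> `|g t| <= M.
  move=> /andP[_ tT]; rewrite /g /concat tT.
  exact: le_trans (coord_le_norm _ _ _) (vM t).
have mg : measurable_fun (`[0, +oo[ : set R) g.
  apply: (@measurable_fun_itv_cat _ T) => //.
    apply: eq_measurable_fun (mv j) => t; rewrite inE/= in_itv/= => /andP[_ tT].
    by rewrite /g /concat tT.
  have cbj : {within `]T, +oo[, continuous (fun t => b (t - T) j 0)}.
    apply: (@continuous_subspaceW _ _ _ `[T, +oo[).
      by apply: subset_itvr; rewrite bnd_simp.
    apply: within_continuous_coord; exact: within_continuous_shift_half_line.
  apply: eq_measurable_fun (subspace_continuous_measurable_fun _ cbj) => // t.
  by rewrite inE/= in_itv/= andbT => Tt; rewrite /g /concat (leNgt t) Tt.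
case: hp => [->|[r [-> r1 ra]]]; last exact: (@Lfun_decay _ g T M D alpha).
apply: (@Lfun_bounded _ _ (M + D)); first exact/(measurable_restrictT _ _).1.
move=> t; have M0 : 0 <= M := le_trans (normr_ge0 _) (vM 0).
rewrite patchE; case: ifPn => [|_]; last by rewrite normr0 addr_ge0.
rewrite inE/= in_itv/= andbT => t0; have [tT|Tt] := leP t T.
  by rewrite (le_trans (gM t _)) ?t0// lerDl.
rewrite (le_trans (gD t Tt))// (@le_trans _ _ D)//; last by rewrite lerDr.
by rewrite ler_piMr// -[leRHS](powRr0 (t - T + 1)) ler_powR//; lra.
Qed.

(** The control [w] is found before [p] is quantified, so the same [w] lies in L_p and in
    L_infty. *)
Lemma near_optimal_control z0 u alpha (e : R) : L1loc R k u ->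
  2^-1 < alpha -> locally_stabilizable f G alpha -> 0 < e ->
  (J0infty P f G z0 u < +oo)%E ->
  exists2 w : R -> 'cV[R]_k,
    (forall p : \bar R, p = +oo%E \/ (exists r : R, [/\ p = r%:E, 1 <= r & 1 < r * alpha]) ->
      Lp k p w) &
    (J0infty P f G z0 w <= J0infty P f G z0 u + e%:E)%E.
Proof.
move=> iu a2 [ub [C [lub ub0 stab]]] e0 Joo.
have a0 : 0 <= alpha by lra.
have [x tx] : exists x, trajectory f G z0 u x.
  by move: Joo; rewrite /J0infty; case: pselect.
rewrite (J0infty_trajectory iu tx) in Joo *.
have [cx _] := tx.
have [Lub Lub0 ubL] : exists2 L : R, 0 <= L & forall a b, `|ub a - ub b| <= L * `|a - b|.
  have [L [Lreal LP]] := lub.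
  exists (`|L| + 1) => // a b; apply: (LP (`|L| + 1) _ (a, b)) => //.
  by rewrite (le_lt_trans (ler_norm L))// ltrDl.
have cub : continuous ub by apply: lipschitz_le_continuous Lub0 _ => a b; exact: ubL.
have [rho rho0 stabP] : exists2 rho : R, 0 < rho & forall a : 'cV[R]_n, `|a| <= rho ->
    exists z, trajectory f G a (ub \o z) z /\
      forall t, 0 <= t -> enorm (z t) <= C * enorm a * (t + 1) `^ (- alpha).
  move: stab => /nbhs_norm0P[r r0 rP]; exists (r / 2); first by rewrite divr_gt0.
  by move=> a ar; apply: rP; rewrite /= (le_lt_trans ar)//; rewrite /= in r0; lra.
have [K K0 qK] := quadform_dist P.
(* [|C|] because the sign of [C] is unknown; [n%:R] converts the Euclidean norm of the initial state
   to the sup norm. *)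
set C1 := `|C| * n%:R; have C10 : 0 <= C1 by rewrite mulr_ge0.
(* The tail costs at most [A * d ^+ 2] when the feedback starts from a state of norm at most
   [2 * d]. *)
pose A := K * (C1 * 2) ^+ 2 / (2 * alpha - 1).
have A0 : 0 <= A by rewrite mulr_ge0 ?mulr_ge0 ?sqr_ge0// invr_ge0; lra.
(* The bound 1 gives d^2 <= d, so that a linear condition controls the tail; [rho / 2] puts [y T],
   of norm at most [2 * d], in the stabilizable ball; the last term makes the tail cost at most
   [e / 2]. *)
pose d := Num.min 1 (Num.min (rho / 2) (e / 2 / (A + 1))).
have d0 : 0 < d by rewrite !lt_min ltr01 !divr_gt0// ltr_wpDl.
have d1 : d <= 1 by rewrite ge_min lexx.
have drho : 2 * d <= rho.
  have : d <= rho / 2 by rewrite !ge_min lexx !orbT.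
  by lra.
have dA : A * d ^+ 2 <= e / 2.
  have : d <= e / 2 / (A + 1) by rewrite !ge_min lexx !orbT.
  rewrite ler_pdivlMr; last by rewrite ltr_wpDl.
  have : d ^+ 2 <= d by rewrite expr2 ler_piMr// ltW.
  move=> /(ler_wpM2l A0); lra.
have [T T0 xT] := finite_cost_small_state d0 cx Joo.
have sx := trajectory_solution_on T tx.
have [cxT _] := sx.
have [Kx Kx0 xK] := within_continuous_bounded T0 cxT.
(* With |y - x| <= e1 <= d <= 1 on [0, T], |y| + |x| is at most 2 Kx + 1, so the two costs there
   differ by at most [B * e1]. *)
pose B := T * (K * (2 * Kx + 1)).
have B0 : 0 <= B by rewrite !mulr_ge0// addr_ge0// mulr_ge0.
pose e1 := Num.min d (e / 2 / (B + 1)).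
have e10 : 0 < e1 by rewrite lt_min d0 !divr_gt0// ltr_wpDl.
have e1d : e1 <= d by rewrite ge_min lexx.
have e1B : B * e1 <= e / 2.
  have : e1 <= e / 2 / (B + 1) by rewrite ge_min lexx orbT.
  rewrite ler_pdivlMr; last by rewrite ltr_wpDl.
  by have := e10; lra.
have [M [v [y [vM mv sy yx]]]] :=
  bounded_control_approx lfG cfG T0 e10 (fun j => iu j T T0) sx.
have [cyT _] := sy.
have yT : `|y T| <= 2 * d.
  rewrite -[y T](subrK (x T)) (le_trans (ler_normD _ _))//.
  have := yx T; rewrite T0 lexx => /(_ isT); lra.
have [z [tz zdec]] := stabP _ (le_trans yT drho).
have [cz _] := tz.
have zC t : 0 <= t -> `|z t| <= C1 * (2 * d) * (t + 1) `^ (- alpha).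
  move=> t0; rewrite (le_trans (norm_le_enorm _))// (le_trans (zdec t t0))//.
  rewrite ler_wpM2r ?powR_ge0// (@le_trans _ _ (`|C| * enorm (y T)))//.
    by rewrite ler_wpM2r ?sqrtr_ge0// ler_norm.
  rewrite /C1 -mulrA ler_wpM2l// (le_trans (enorm_le_norm _))//.
  by rewrite ler_wpM2l.
pose w := concat T v (ub \o z); pose X := concat T y z.
have iv j := integrable_bounded_control vM (mv j).
have tX : trajectory f G z0 w X by exact: concat_trajectory.
have cbz : {within `[0, +oo[, continuous (ub \o z)} by exact: within_continuous_comp_cV.
have wLp p : p = +oo%E \/ (exists r : R, [/\ p = r%:E, 1 <= r & 1 < r * alpha]) -> Lp k p w.
  apply: (@concat_in_Lp T M (Lub * (C1 * (2 * d))) alpha) => //.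
    by rewrite !mulr_ge0// ltW.
  move=> t t0; have := ubL (z t) 0; rewrite ub0 !subr0 => /le_trans; apply.
  by rewrite -mulrA ler_wpM2l// zC.
exists w => //.
rewrite (J0infty_trajectory _ tX); last by apply: Linfty_sub_L1loc; apply: wLp; left.
have [cX _] := tX.
have mqX : measurable_fun (`[0%R, +oo[ : set R) (fun t => (quadform P (X t))%:E).
  by apply/measurable_EFinP; exact: measurable_quadform_comp.
have Tb : (BRight T <= +oo%O :> itv_bound R)%O by rewrite bnd_simp.
rewrite [in leLHS](itv_cc_split Tb T0) ge0_integral_setU//; last 3 first.
- by rewrite -(itv_cc_split Tb T0).
- by move=> t _; rewrite lee_fin quadform_ge0.
- exact: disjoint_itv_split.
have -> : e%:E = ((e / 2)%:E + (e / 2)%:E)%E by rewrite -EFinD -splitr.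
rewrite [leRHS]addeA; apply: leeD.
- have mq : measurable_fun (`[0%R, T] : set R) (fun t => (quadform P (x t))%:E).
    by apply/measurable_EFinP; exact: measurable_quadform_comp.
  apply: (@le_trans _ _ (\int[mu]_(t in `[0%R, T])
      ((quadform P (x t))%:E + (K * (2 * Kx + 1) * e1)%:E))%E).
    apply: ge0_le_integral => //.
    + by move=> t _; rewrite lee_fin quadform_ge0.
    + by apply: measurable_funS mqX => //; apply: subset_itvl; rewrite bnd_simp.
    + exact: emeasurable_funD.
    + move=> t; rewrite /= in_itv/= => tT; rewrite -EFinD lee_fin.
      have -> : X t = y t by case/andP: tT => _ tT; rewrite /X /concat tT.
      rewrite -lerBlDl (le_trans (ler_norm _))// (le_trans (qK _ _))// -mulrA ler_wpM2l//.
      rewrite mulrC ler_pM// ?addr_ge0// ?yx//.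
      have : `|y t| <= `|y t - x t| + `|x t|.
        by rewrite -{1}[y t](subrK (x t)) ler_normD.
      have := yx t tT; have := xK t tT; lra.
  rewrite ge0_integralD//; last 2 first.
  + by move=> t _; rewrite lee_fin quadform_ge0.
  + by move=> t _; rewrite lee_fin !mulr_ge0 ?addr_ge0 ?mulr_ge0// ltW.
  apply: leeD.
    apply: ge0_subset_integral => //.
    + by apply/measurable_EFinP; exact: measurable_quadform_comp.
    + by move=> t _; rewrite lee_fin quadform_ge0.
    + by apply: subset_itvl; rewrite bnd_simp.
  rewrite integral_cst//= lebesgue_measure_itv/= lte_fin; case: ifPn => _.
    rewrite -EFinD subr0 -EFinM lee_fin (le_trans _ e1B)// /B.
    by rewrite le_eqVlt; apply/orP; left; apply/eqP; ring.
  by rewrite mule0 lee_fin divr_ge0// ltW.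
- apply: (@le_trans _ _ (K * (C1 * (2 * d)) ^+ 2 / (2 * alpha - 1))%:E); last first.
    rewrite lee_fin (le_trans _ dA)// /A.
    suff -> : K * (C1 * (2 * d)) ^+ 2 / (2 * alpha - 1) =
      K * (C1 * 2) ^+ 2 / (2 * alpha - 1) * d ^+ 2 by [].
    by ring.
  apply: tail_integral_le => //.
  + apply/measurable_EFinP; apply: measurable_funS mqX => //.
    by apply: subset_itvr; rewrite bnd_simp.
  + by rewrite mulr_ge0 ?sqr_ge0.
  + move=> t Tt; rewrite quadform_ge0/= /X /concat (leNgt t) Tt/= -mulrA -exprMn.
    have tT0 : 0 <= t - T by rewrite subr_ge0 ltW.
    (* Comparison with the zero state bounds the density by K |z|^2. *)
    have := qK 0 (z (t - T)); rewrite quadform0 !subr0 normr0 addr0 -expr2.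
    move=> /(le_trans (ler_norm _)) /le_trans; apply.
    by rewrite ler_wpM2l// lerXn2r ?nnegrE ?zC// mulr_ge0 ?powR_ge0// mulr_ge0// mulr_ge0// ltW.
Qed.

Lemma no_gap z0 (p : \bar R) (alpha : R) : 2^-1 < alpha ->
  p = +oo%E \/ (exists r : R, [/\ p = r%:E, 1 <= r & 1 < r * alpha]) ->
  locally_stabilizable f G alpha ->
  ereal_inf [set J0infty P f G z0 u | u in Lp k p `&` Lp k +oo%E]
    = ereal_inf [set J0infty P f G z0 u | u in L1loc R k].
Proof.
move=> a2 hp stab; apply/eqP; rewrite eq_le; apply/andP; split; last first.
  apply: ereal_inf_le_tmp => _ [u [_ uoo] <-]; exists u => //.
  exact: Linfty_sub_L1loc.
apply: le_ereal_inf_tmp => _ [u iu <-].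
have [Joo|] := ltP (J0infty P f G z0 u) +oo%E; last first.
  by rewrite leye_eq => /eqP ->; rewrite leey.
apply/lee_addgt0Pr => e e0.
have [w wLp Jw] := near_optimal_control iu a2 stab e0 Joo.
apply: le_trans Jw; apply: ereal_inf_lbound; exists w => //.
by split; apply: wLp => //; left.
Qed.

End LavrentievGap.

Unset Implicit Arguments.
Set Strict Implicit.
Set Printing Implicit Defensive.

Theorem theorem2p5 (R : realType) (n k : nat) (P : 'M[R]_n)
    (f : 'cV[R]_n -> 'cV[R]_n) (g : 'I_k -> 'cV[R]_n -> 'cV[R]_n)
    (x0 : 'cV[R]_n)
    (hP : sym_posdef P) (hf : smooth f) (hg : forall j, smooth (g j)) :
  let G := fields_mx g in
  let J := J0infty P f G x0 in
  (forall p alpha : R, 1 <= p -> p < 2 -> p^-1 < alpha ->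
     locally_stabilizable f G alpha ->
     ereal_inf [set J u | u in Lp k p%:E `&` Lp k +oo%E]
       = ereal_inf [set J u | u in L1loc R k]) /\
  (forall (p : \bar R) (alpha : R), (2%:E <= p)%E -> 2^-1 < alpha ->
     locally_stabilizable f G alpha ->
     ereal_inf [set J u | u in Lp k p `&` Lp k +oo%E]
       = ereal_inf [set J u | u in L1loc R k]).
Proof.
move=> G J; have [lfG cfG] := smooth_system hf hg.
split=> [p alpha p1 p2 pa|p alpha p2 a2] stab.
  have p0 : 0 < p by lra.
  (* Since p < 2, 1/2 < 1/p < alpha. *)
  apply: (@no_gap _ _ _ _ _ _ lfG cfG hP _ _ alpha) => //.
    by rewrite (lt_trans _ pa)// ltf_pV2// posrE.
  right; exists p; split => //.
  by move: pa; rewrite -[X in X < _ -> _]mul1r ltr_pdivrMr// mulrC.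
apply: (@no_gap _ _ _ _ _ _ lfG cfG hP _ _ alpha) => //.
case: p p2 => [r|_|]//; last by left.
rewrite lee_fin => r2; right; exists r; split => //; first lra.
(* For finite r >= 2 the integrability condition follows from 1 < 2 alpha <= r alpha. *)
have : 2 * alpha <= r * alpha by rewrite ler_wpM2r//; lra.
lra.
Qed.
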